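(* Fix an integer $n\geq 2$ and an odd integer $k\geq 3$, and let $P\in \mathbb{R}[X_1,\dots,X_n]$ be a polynomial of degree $k$ with leading form (homogeneous part of degree $k$) $P_k= c_1X_1^k+c_2X_2^k +Q$, where $c_1>0$, $c_2>0$ are real and $Q\in \mathbb{R}[X_3,\dots,X_n]$ is a form of degree $k$. Let $s\in\mathbb{R}$ and suppose there exists a constant $C_s$ such that \[ \Big\|\sup_{0<t<1}|T_t^Pf|\Big\|_{L^1(B_n(0,1))} \leq C_s \|f\|_{H^s(\mathbb{R}^n)}\qquad \text{for all } f\in H^s(\mathbb{R}^n). \] Then $s\geq 1/3$.
   Context: A form of degree $e$ is a homogeneous polynomial of degree $e$; the zero polynomial is allowed (in particular $Q=0$ when $n=2$). The Fourier transform is $\hat f(\xi)=\int_{\mathbb{R}^n} f(x)e^{-ix\cdot\xi}\,dx$. For a real polynomial $P$ in $n$ variables, define \[ T_t^{P}f(x) = \frac{1}{(2\pi)^n} \int_{\mathbb{R}^n} \hat{f}(\xi) e^{i(x\cdot \xi + P(\xi)t)}\,d\xi , \] initially for $f$ of Schwartz class on $\mathbb{R}^n$ (and extended to $H^s$ as the Fourier multiplier $e^{iP(\xi)t}$). The Sobolev space $H^s(\mathbb{R}^n)$ consists of all tempered distributions $f$ with finite norm given by $\|f\|_{H^s(\mathbb{R}^n)}^2=(2\pi)^{-n}\int_{\mathbb{R}^n}(1+|\xi|^2)^s|\hat f(\xi)|^2\,d\xi$. $B_n(0,1)$ is the unit ball in $\mathbb{R}^n$ centered at the origin. *)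

(* Defs.v *)
From HB Require Import structures.
From mathcomp Require Import all_boot all_order all_algebra.
From mathcomp Require Import -(notations) mpoly.
From mathcomp Require Import all_classical all_reals all_analysis.
From mathcomp Require Import measurable_realfun complex.

Set Implicit Arguments.
Unset Strict Implicit.
Unset Printing Implicit Defensive.

Import Order.TTheory GRing.Theory Num.Theory.
Import numFieldNormedType.Exports.

Local Open Scope classical_set_scope.
Local Open Scope ring_scope.
Local Open Scope complex_scope.

Definition rV_display : measure_display.
Proof. exact: default_measure_display. Qed.

(* 'rV[R]_n carries the sigma-algebra generated by the coordinates, that is,
   the Borel sigma-algebra. *)
Section measurable_rV.
Context (R : realType) (n : nat).

Let coord (i : 'I_n) (x : 'rV[R]_n) : measurableTypeR R := x ord0 i.

Let rV_set0 : g_sigma_preimage coord set0.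
Proof. exact: sigma_algebra0. Qed.

Let rV_setC A : g_sigma_preimage coord A -> g_sigma_preimage coord (~` A).
Proof. exact: sigma_algebraC. Qed.

Let rV_bigcup (F : (set 'rV[R]_n)^nat) :
  (forall i, g_sigma_preimage coord (F i)) ->
  g_sigma_preimage coord (\bigcup_i (F i)).
Proof. exact: sigma_algebra_bigcup. Qed.

HB.instance Definition _ := @isMeasurable.Build rV_display 'rV[R]_n
  (g_sigma_preimage coord) rV_set0 rV_setC rV_bigcup.

End measurable_rV.

Section lebesgue_rV.
Context (R : realType).

Let coord n (i : 'I_n) (x : 'rV[R]_n) : measurableTypeR R := x ord0 i.

Lemma measurable_coord n (i : 'I_n) :
  measurable_fun [set: 'rV[R]_n] (coord i : 'rV[R]_n -> measurableTypeR R).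
Proof.
move=> _ Y mY; rewrite setTI; apply: sub_sigma_algebra => /=.
rewrite -bigcup_seq/=; exists i => /=; first by rewrite mem_index_enum.
by exists Y => //; rewrite setTI.
Qed.

Lemma measurable_fun_rVP d (T : measurableType d) n (f : T -> 'rV[R]_n) :
  measurable_fun setT f <->
  forall i, measurable_fun setT (fun t => f t ord0 i : measurableTypeR R).
Proof.
split=> [mf i|mf].
  exact: (measurableT_comp (measurable_coord i) mf).
move=> _ A mA; rewrite setTI.
have sub : g_sigma_preimage (@coord n) `<=` [set B | measurable (f @^-1` B)].
  apply: smallest_sub.
    split => /=.
    - by rewrite preimage_set0; exact: measurable0.
    - by move=> B mB; rewrite setTD preimage_setC; exact: measurableC.
    - move=> F mF; rewrite preimage_bigcup; apply: bigcupT_measurable => k.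
      exact: mF.
  rewrite -bigcup_seq/= => B [i /= _] [C mC <-]; rewrite setTI.
  by have := mf i measurableT _ mC; rewrite setTI.
exact: sub.
Qed.

Definition rV_cons n (p : measurableTypeR R * 'rV[R]_n) : 'rV[R]_n.+1 :=
  row_mx (p.1 : R)%:M p.2.

Definition rV_uncons n (x : 'rV[R]_n.+1) : measurableTypeR R * 'rV[R]_n :=
  (x ord0 ord0, rsubmx (x : 'rV[R]_(1 + n))).

Lemma rV_cons0 n (p : measurableTypeR R * 'rV[R]_n) :
  rV_cons p ord0 ord0 = p.1.
Proof.
have -> : (ord0 : 'I_n.+1) = lshift n (ord0 : 'I_1) by exact/val_inj.
by rewrite /rV_cons [LHS](row_mxEl (p.1 : R)%:M) mxE eqxx mulr1n.
Qed.

Lemma rV_consK n : cancel (@rV_cons n) (@rV_uncons n).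
Proof.
by move=> [a y]; rewrite /rV_uncons rV_cons0 /rV_cons row_mxKr.
Qed.

Lemma measurable_rV_cons n : measurable_fun setT (@rV_cons n).
Proof.
apply/measurable_fun_rVP => i.
case: (unliftP ord0 i) => [j ->|->].
  rewrite (_ : (fun t => _) = (fun t : measurableTypeR R * 'rV[R]_n =>
      coord j t.2)).
    exact: (measurableT_comp (measurable_coord j) measurable_snd).
  apply/funext => t; rewrite /rV_cons.
  rewrite (_ : lift ord0 j = rshift 1 j); last exact/val_inj.
  by rewrite [LHS](row_mxEr (t.1 : R)%:M).
rewrite (_ : (fun t => _) = fst); first exact: measurable_fst.
by apply/funext => t; exact: rV_cons0.
Qed.

Lemma measurable_rV_uncons n : measurable_fun setT (@rV_uncons n).
Proof.
apply/measurable_fun_pairP; split.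
  exact: (measurable_coord ord0).
apply/measurable_fun_rVP => i.
rewrite (_ : (fun t => _) = coord (rshift 1 i)); first exact: measurable_coord.
by apply/funext => t /=; rewrite mxE.
Qed.

Section step.
Context (n : nat) (mu : {sigma_finite_measure set 'rV[R]_n -> \bar R}).

Definition lebesgue_rV_step : set 'rV[R]_n.+1 -> \bar R :=
  pushforward (lebesgue_measure \x mu)%E (@rV_cons n).

Let step0 : lebesgue_rV_step set0 = 0%E.
Proof. by rewrite /lebesgue_rV_step /pushforward preimage_set0 measure0. Qed.

Let step_ge0 A : (0 <= lebesgue_rV_step A)%E.
Proof. exact: (measure_ge0 (lebesgue_measure \x mu)%E). Qed.

Let measurable_preim (A : set 'rV[R]_n.+1) :
  measurable A -> measurable (@rV_cons n @^-1` A).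
Proof.
by move=> mA; rewrite -[X in measurable X]setTI; exact: measurable_rV_cons.
Qed.

Let step_semi_sigma_additive : semi_sigma_additive lebesgue_rV_step.
Proof.
move=> F mF tF mUF; rewrite /lebesgue_rV_step /pushforward preimage_bigcup.
apply: measure_semi_sigma_additive.
- by move=> k; exact: measurable_preim.
- apply/trivIsetP => /= i j _ _ ij; rewrite -preimage_setI.
  by move/trivIsetP : tF => /(_ _ _ _ _ ij) ->//; rewrite preimage_set0.
- by rewrite -preimage_bigcup; exact: measurable_preim.
Qed.

HB.instance Definition _ := isMeasure.Build _ _ _ lebesgue_rV_step
  step0 step_ge0 step_semi_sigma_additive.

Let step_sigma_finite : sigma_finite setT lebesgue_rV_step.
Proof.
have /sigma_finiteP[F [TF ndF Foo]] := sigma_finiteT (@lebesgue_measure R).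
have /sigma_finiteP[G [TG ndG Goo]] := sigma_finiteT mu.
exists (fun k => @rV_uncons n @^-1` (F k `*` G k)).
  rewrite -preimage_bigcup -[LHS](preimage_setT (@rV_uncons n)).
  congr (_ @^-1` _); rewrite -setXTT TF TG predeqE => -[x y]; split.
    move=> [/= [k _ Fkx] [l _ Gly]]; exists (maxn k l) => //; split.
    - by move: x Fkx; exact/subsetPset/ndF/leq_maxl.
    - by move: y Gly; exact/subsetPset/ndG/leq_maxr.
  by move=> [k _ []/= ? ?]; split; exists k.
move=> k; have [mF Fk] := Foo k; have [mG Gk] := Goo k; split.
  by rewrite -[X in measurable X]setTI; apply: measurable_rV_uncons => //;
    exact: measurableX.
rewrite /lebesgue_rV_step /pushforward -comp_preimage.
rewrite (_ : _ \o _ = id); last by apply/funext => p; exact: rV_consK.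
by rewrite preimage_id product_measure1E// lte_mul_pinfty// ge0_fin_numE.
Qed.

HB.instance Definition _ := Measure_isSigmaFinite.Build _ _ _ lebesgue_rV_step
  step_sigma_finite.

End step.

Fixpoint lebesgue_rV n : {sigma_finite_measure set 'rV[R]_n -> \bar R} :=
  match n with
  | 0 => @dirac _ 'rV[R]_0 0 R
  | m.+1 => lebesgue_rV_step (lebesgue_rV m)
  end.

End lebesgue_rV.
Arguments lebesgue_rV {R} n.

Section complex_functions.
Context (R : realType) (n : nat).
Implicit Types (f g phi psi : 'rV[R]_n -> R[i]) (x xi : 'rV[R]_n).

Definition dotp x xi : R := \sum_(i < n) x ord0 i * xi ord0 i.

(* The Euclidean |x|^2: the library norm of 'rV[R]_n is the sup norm. *)
Definition sqnorm x : R := dotp x x.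

Definition unit_ball : set 'rV[R]_n := [set x | Num.sqrt (sqnorm x) < 1].

Definition cexpi (theta : R) : R[i] := cos theta +i* sin theta.

Definition Cmeasurable (D : set 'rV[R]_n) f :=
  measurable_fun D (fun x => complex.Re (f x)) /\
  measurable_fun D (fun x => complex.Im (f x)).

Definition Cintegrable (D : set 'rV[R]_n) f :=
  (lebesgue_rV n).-integrable D (fun x => (complex.Re (f x))%:E) /\
  (lebesgue_rV n).-integrable D (fun x => (complex.Im (f x))%:E).

Definition Cintegral (D : set 'rV[R]_n) f : R[i] :=
  (\int[lebesgue_rV n]_(x in D) complex.Re (f x))
    +i* (\int[lebesgue_rV n]_(x in D) complex.Im (f x)).

Definition fourier f xi : R[i] :=
  Cintegral setT (fun x => f x * cexpi (- dotp x xi)).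

Definition partials (h : 'rV[R]_n -> R) (s : seq 'I_n) : 'rV[R]_n -> R :=
  foldr (fun (i : 'I_n) (h' : 'rV[R]_n -> R) => 'D_(delta_mx ord0 i) h') h s.

Definition smooth f :=
  forall (s : seq 'I_n) x,
    differentiable (partials (fun y => complex.Re (f y)) s) x /\
    differentiable (partials (fun y => complex.Im (f y)) s) x.

Definition Cpartials f (s : seq 'I_n) x : R[i] :=
  partials (fun y => complex.Re (f y)) s x
    +i* partials (fun y => complex.Im (f y)) s x.

Definition schwartz_bound f (N : nat) (M : R) :=
  forall s : seq 'I_n, (size s <= N)%N -> forall x,
    (1 + sqnorm x) ^+ N * ComplexField.Normc.normc (Cpartials f s x) <= M.

Definition schwartz f := smooth f /\ forall N, exists M, schwartz_bound f N M.

Definition test_function (D : set 'rV[R]_n) f :=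
  [/\ smooth f, compact (closure [set x | f x != 0]) &
      closure [set x | f x != 0] `<=` D].

(* Only the values of u on Schwartz functions are meaningful. *)
Definition tempered_distribution (u : ('rV[R]_n -> R[i]) -> R[i]) :=
  (forall (a : R[i]) phi psi, schwartz phi -> schwartz psi ->
    u (fun x => a * phi x + psi x) = a * u phi + u psi) /\
  exists (N : nat) (C : R), forall phi (M : R), schwartz phi ->
    schwartz_bound phi N M -> ComplexField.Normc.normc (u phi) <= C * M.

(* The Fourier transform of u, i.e. the distribution phi |-> u (fourier phi),
   is the function uhat. *)
Definition fourier_is (u : ('rV[R]_n -> R[i]) -> R[i]) (uhat : 'rV[R]_n -> R[i])
    :=
  Cmeasurable setT uhat /\
  forall phi, schwartz phi ->
    Cintegrable setT (fun xi => uhat xi * phi xi) /\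
    u (fourier phi) = Cintegral setT (fun xi => uhat xi * phi xi).

Definition sobolev_sqnorm (s : R) (uhat : 'rV[R]_n -> R[i]) : \bar R :=
  (((2 * pi) ^- n)%:E * \int[lebesgue_rV n]_xi
     ((1 + sqnorm xi) `^ s * ComplexField.Normc.normc (uhat xi) ^+ 2)%:E)%E.

Definition sobolev_norm (s : R) (uhat : 'rV[R]_n -> R[i]) : R :=
  Num.sqrt (fine (sobolev_sqnorm s uhat)).

(* u belongs to H^s(R^n), with Fourier transform uhat. *)
Definition in_sobolev (s : R) (u : ('rV[R]_n -> R[i]) -> R[i])
    (uhat : 'rV[R]_n -> R[i]) :=
  [/\ tempered_distribution u, fourier_is u uhat &
      (sobolev_sqnorm s uhat < +oo)%E].

(* The distribution T_t^P u, where uhat is the Fourier transform of u: pairing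
   (2 pi)^-n int uhat(xi) exp(i (x.xi + P(xi) t)) dxi with a Schwartz function
   psi(x) and integrating in x first produces fourier psi (- xi). *)
Definition propagator (P : mpoly n R) (t : R) (uhat : 'rV[R]_n -> R[i])
    psi : R[i] :=
  ((2 * pi) ^- n)%:C * Cintegral setT (fun xi =>
    uhat xi * cexpi (meval (fun i => xi ord0 i) P * t)
      * fourier psi (- xi)).

Definition is_function_on (D : set 'rV[R]_n) (v : ('rV[R]_n -> R[i]) -> R[i])
    (F : 'rV[R]_n -> R[i]) :=
  Cintegrable D F /\
  forall psi, test_function D psi ->
    v psi = Cintegral D (fun x => F x * psi x).

Definition sup_modulus (F : R -> 'rV[R]_n -> R[i]) x : \bar R :=
  ereal_sup [set (ComplexField.Normc.normc (F t x))%:E | t in `]0, 1[].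

(* || sup_{0<t<1} |T_t^P u| ||_{L^1(B_n(0,1))} <= M.  For u in H^s, T_t^P u is
   determined only up to a null set for each t, so the supremum is that of
   suitable representatives F t, chosen so that it is measurable. *)
Definition maximal_L1_le (P : mpoly n R) (uhat : 'rV[R]_n -> R[i])
    (M : R) :=
  exists F : R -> 'rV[R]_n -> R[i],
    [/\ forall t, 0 < t < 1 ->
          is_function_on unit_ball (propagator P t uhat) (F t),
        measurable_fun unit_ball (fun x => sup_modulus F x) &
        (\int[lebesgue_rV n]_(x in unit_ball) sup_modulus F x <= M%:E)%E].

End complex_functions.

Definition free_of_first (R : realType) (n d : nat) (Q : mpoly n R) :=
  forall m, m \in msupp Q -> forall i : 'I_n, (i < d)%N -> m i = 0%N.

(* Main.v *)
Require Import Defs.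
From mathcomp Require Import all_boot all_order all_algebra.
From mathcomp Require Import -(notations) mpoly.
From mathcomp Require Import all_classical all_reals all_analysis.
From mathcomp Require Import measurable_realfun complex.
From mathcomp Require Import ring lra.

(** In the coordinates [u = xi_1 + rho xi_2], [v = xi_1 - rho xi_2], where
    [rho = (c_2 / c_1) ^ (1 / k)], the first two terms of the leading form are a
    multiple of [k u v ^ (k - 1) + 'C(k, 3) u ^ 3 v ^ (k - 3) + ...]: as [k] is
    odd, there is no [u ^ 2] term. Take for the Fourier transform of [f] a sum of
    [J = m ^ 2] bumps of unit size along the line [v = 2 N], [0 <= u <= 2 J],
    with [N = m ^ 3]. For [x] near [0], the time [t] of size [N ^ (1 - k)]
    for which [t k u v ^ (k - 1)] cancels the part of [x . xi] linear in [u]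
    makes the phase nearly constant on the whole train, because
    [J ^ 3 <= N ^ 2]. Hence the maximal function is at least of order [J] on a
    fixed set, whereas the [H ^ s] norm of [f] is of order
    [N ^ s J ^ (1 / 2) = m ^ (3 s + 1)], and [m -> oo] gives [s >= 1 / 3].

    Two devices keep the argument elementary. The function [f] is
    [prod_i (1 + |x_i|) exp (- |x_i|)] times an exponential sum, whose Fourier
    transform is explicit, so no inversion theorem is needed. The maximal
    function is bounded below by pairing [T_t f], for the time [t] attached to
    each cube of a fine grid, with a smooth bump supported in that cube, so the
    distribution [T_t f] need not be identified with a function. *)

Set Implicit Arguments.
Unset Strict Implicit.
Unset Printing Implicit Defensive.

Import Order.TTheory GRing.Theory Num.Theory.
Import numFieldNormedType.Exports.
Local Open Scope classical_set_scope.
Local Open Scope ring_scope.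
Local Open Scope complex_scope.

(** * Complex-valued integrals *)

Local Notation normc := ComplexField.Normc.normc.
Local Notation Re := complex.Re.
Local Notation Im := complex.Im.

Section complex_numbers.
Context {R : realType}.
Implicit Types (z w : R[i]) (a b : R).

(** The sizes are dictated by the cubic term: for [t] of size [N ^ (1 - k)] it adds [J ^ 3 / N ^ 2]
    to the phase, so [J = N ^ (2 / 3)] is the longest train allowed, and [J <= C N ^ s J ^ (1 / 2)]
    then reads [N ^ (1 / 3) <= C N ^ s]. The lower-order terms of [P] are arbitrary and of size
    [N ^ (k - 1)]; multiplied by [t] they are bounded but need not be small. Smallness comes from
    keeping [x] within a small constant of the origin: the same constant then appears in [t], hence
    in every error.

    An explicit profile has only polynomial tails. The phase error grows with the distance from [xi]
    to the centre [c] of its bump and is bounded by the weight [prod_i (1 + (xi_i - c_i) ^ 2)]. The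
    profile is chosen so that its transform [prod_i (1 + xi_i ^ 2) ^ (- 2)] stays integrable against
    this weight, which the transform of [prod_i exp (- |x_i|)] does not. The same weight absorbs the
    Sobolev weight. *)

Lemma ReD z w : Re (z + w) = Re z + Re w. Proof. by case: z; case: w. Qed.
Lemma ImD z w : Im (z + w) = Im z + Im w. Proof. by case: z; case: w. Qed.
Lemma ReM z w : Re (z * w) = Re z * Re w - Im z * Im w.
Proof. by case: z; case: w. Qed.
Lemma ImM z w : Im (z * w) = Re z * Im w + Im z * Re w.
Proof. by case: z; case: w. Qed.

Lemma eqC z w : Re z = Re w -> Im z = Im w -> z = w.
Proof. by case: z => a b; case: w => c d /= -> ->. Qed.

Lemma normc_ge0 z : 0 <= normc z.
Proof. by case: z => a b; exact: sqrtr_ge0. Qed.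

Lemma le_Re_normc z : `|Re z| <= normc z.
Proof.
by case: z => a b /=; rewrite -sqrtr_sqr ler_sqrt ?addr_ge0 ?sqr_ge0// lerDl sqr_ge0.
Qed.

Lemma le_Im_normc z : `|Im z| <= normc z.
Proof.
by case: z => a b /=; rewrite -sqrtr_sqr ler_sqrt ?addr_ge0 ?sqr_ge0// lerDr sqr_ge0.
Qed.

Lemma normc_real a : normc (a%:C) = `|a|.
Proof. by rewrite /= expr0n addr0 sqrtr_sqr. Qed.

Lemma normc_le_ReIm z : normc z <= `|Re z| + `|Im z|.
Proof.
rewrite [in leLHS](complexE z); apply: le_trans (le_normcD _ _) _.
rewrite ComplexField.Normc.normcM normc_real lerD2l.
by rewrite normc_real /= !expr0n expr1n /= add0r sqrtr1 mul1r.
Qed.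

Lemma normc_sum (I : Type) (r : seq I) (P : pred I) (F : I -> R[i]) :
  normc (\sum_(i <- r | P i) F i) <= \sum_(i <- r | P i) normc (F i).
Proof.
apply: (big_ind2 (fun z a => normc z <= a)) => //.
  by rewrite ComplexField.Normc.normc0.
by move=> z a w b za wb; apply: le_trans (le_normcD _ _) (lerD za wb).
Qed.

Lemma cexpi0 : cexpi (0 : R) = 1.
Proof. by rewrite /cexpi cos0 sin0. Qed.

Lemma cexpiD a b : cexpi (a + b) = cexpi a * cexpi b.
Proof. by rewrite /cexpi cosD sinD; apply: eqC => //=; rewrite addrC. Qed.

Lemma normc_cexpi a : normc (cexpi a) = 1.
Proof. by rewrite /= cos2Dsin2 sqrtr1. Qed.

Lemma cexpi_sum (I : Type) (r : seq I) (F : I -> R) :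
  cexpi (\sum_(i <- r) F i) = \prod_(i <- r) cexpi (F i).
Proof.
apply: (big_morph (@cexpi R)); [exact: cexpiD|exact: cexpi0].
Qed.

End complex_numbers.

Section complex_integral.
Context d (T : measurableType d) (R : realType).
Variable mu : {measure set T -> \bar R}.
Implicit Types (D : set T) (f g : T -> R[i]).

(** These restate [Cmeasurable], [Cintegrable] and [Cintegral] over an arbitrary measure, to which
    they are convertible for [lebesgue_rV n]; Fubini's theorem needs them on product spaces. *)
Definition Cmeas D f :=
  measurable_fun D (fun x => Re (f x)) /\ measurable_fun D (fun x => Im (f x)).

Definition Cintg D f :=
  mu.-integrable D (fun x => (Re (f x))%:E) /\
  mu.-integrable D (fun x => (Im (f x))%:E).

Definition Cint D f : R[i] :=
  (\int[mu]_(x in D) Re (f x)) +i* (\int[mu]_(x in D) Im (f x)).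

Lemma Cmeas_cst D (c : R[i]) : Cmeas D (fun=> c).
Proof. by split; exact: measurable_cst. Qed.

Lemma CmeasD D f g : Cmeas D f -> Cmeas D g -> Cmeas D (fun x => f x + g x).
Proof.
move=> [f1 f2] [g1 g2]; split.
  by under eq_fun do rewrite ReD; exact: measurable_funD.
by under eq_fun do rewrite ImD; exact: measurable_funD.
Qed.

Lemma CmeasM D f g : Cmeas D f -> Cmeas D g -> Cmeas D (fun x => f x * g x).
Proof.
move=> [f1 f2] [g1 g2]; split.
  under eq_fun do rewrite ReM.
  by apply: measurable_funB; exact: measurable_funM.
under eq_fun do rewrite ImM.
by apply: measurable_funD; exact: measurable_funM.
Qed.

Lemma Cmeas_real D (f : T -> R) :
  measurable_fun D f -> Cmeas D (fun x => (f x)%:C).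
Proof. by move=> mf; split => //=; exact: measurable_cst. Qed.

Lemma Cmeas_cexpi D (f : T -> R) :
  measurable_fun D f -> Cmeas D (fun x => cexpi (f x)).
Proof.
move=> mf; split => /=.
  apply: measurableT_comp => //; apply: continuous_measurable_fun.
  exact: continuous_cos.
apply: measurableT_comp => //; apply: continuous_measurable_fun.
exact: continuous_sin.
Qed.

Lemma Cmeas_prod D I (r : seq I) (F : I -> T -> R[i]) :
  (forall i, Cmeas D (F i)) -> Cmeas D (fun x => \prod_(i <- r) F i x).
Proof.
move=> mF; elim: r => [|a r IHr].
  by under eq_fun do rewrite big_nil; exact: Cmeas_cst.
by under eq_fun do rewrite big_cons; exact: CmeasM.
Qed.

Lemma measurable_normc D f :
  Cmeas D f -> measurable_fun D (fun x => normc (f x)).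
Proof.
move=> [f1 f2].
rewrite (_ : (fun x => _) =
  (fun x => Num.sqrt (Re (f x) ^+ 2 + Im (f x) ^+ 2))); last first.
  by apply/funext => x; case: (f x).
apply: measurableT_comp.
  by apply: continuous_measurable_fun; exact: sqrt_continuous.
by apply: measurable_funD; exact: measurable_funX.
Qed.

Section measurable_domain.
Variable D : set T.
Hypothesis mD : measurable D.

Lemma Cintg_meas f : Cintg D f -> Cmeas D f.
Proof.
by move=> [/measurable_int/measurable_EFinP ? /measurable_int/measurable_EFinP].
Qed.

Lemma Cintg_dom f (g : T -> R) : Cmeas D f -> mu.-integrable D (EFin \o g) ->
  (forall x, D x -> normc (f x) <= g x) -> Cintg D f.
Proof.
move=> [f1 f2] ig fg; split.
  apply: (le_integrable mD) ig => //; first exact/measurable_EFinP.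
  move=> x Dx /=; rewrite lee_fin (le_trans (le_Re_normc _))//.
  by rewrite (le_trans (fg _ Dx))// ler_norm.
apply: (le_integrable mD) ig => //; first exact/measurable_EFinP.
move=> x Dx /=; rewrite lee_fin (le_trans (le_Im_normc _))//.
by rewrite (le_trans (fg _ Dx))// ler_norm.
Qed.

Lemma Cintg_normc f : Cintg D f -> mu.-integrable D (fun x => (normc (f x))%:E).
Proof.
move=> [f1 f2].
apply: (le_integrable mD) (integrableD mD (integrable_abse f1) (integrable_abse f2)).
  apply/measurable_EFinP/measurable_normc; exact: Cintg_meas.
move=> x Dx /=; rewrite lee_fin ger0_norm ?normc_ge0//.
by rewrite ger0_norm ?addr_ge0// normc_le_ReIm.
Qed.

Lemma Cintg0 : Cintg D (fun=> 0).
Proof. by split; exact: integrable0. Qed.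

Lemma CintgD f g : Cintg D f -> Cintg D g -> Cintg D (fun x => f x + g x).
Proof.
move=> [f1 f2] [g1 g2]; split.
  rewrite (_ : (fun x => _) = (fun x => (Re (f x))%:E + (Re (g x))%:E)%E).
    exact: integrableD.
  by apply/funext => x; rewrite ReD.
rewrite (_ : (fun x => _) = (fun x => (Im (f x))%:E + (Im (g x))%:E)%E).
  exact: integrableD.
by apply/funext => x; rewrite ImD.
Qed.

Lemma CintD f g : Cintg D f -> Cintg D g ->
  Cint D (fun x => f x + g x) = Cint D f + Cint D g.
Proof.
move=> [f1 f2] [g1 g2]; apply: eqC; rewrite ?ReD ?ImD /=.
  by rewrite -RintegralD//; apply: eq_Rintegral => x _; rewrite ReD.
by rewrite -RintegralD//; apply: eq_Rintegral => x _; rewrite ImD.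
Qed.

Lemma CintgZ (c : R[i]) f : Cintg D f -> Cintg D (fun x => c * f x).
Proof.
move=> [f1 f2]; split.
  rewrite (_ : (fun x => _) =
    (fun x => (Re c)%:E * (Re (f x))%:E - (Im c)%:E * (Im (f x))%:E)%E).
    by apply: integrableB => //; exact: integrableZl.
  by apply/funext => x; rewrite ReM.
rewrite (_ : (fun x => _) =
    (fun x => (Re c)%:E * (Im (f x))%:E + (Im c)%:E * (Re (f x))%:E)%E).
  by apply: integrableD => //; exact: integrableZl.
by apply/funext => x; rewrite ImM.
Qed.

Lemma CintZ (c : R[i]) f : Cintg D f -> Cint D (fun x => c * f x) = c * Cint D f.
Proof.
move=> [f1 f2].
have i1 a : mu.-integrable D (EFin \o (fun x => a * Re (f x))).
  rewrite (_ : _ \o _ = (fun x => a%:E * (Re (f x))%:E)%E)//.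
  exact: integrableZl.
have i2 a : mu.-integrable D (EFin \o (fun x => a * Im (f x))).
  rewrite (_ : _ \o _ = (fun x => a%:E * (Im (f x))%:E)%E)//.
  exact: integrableZl.
apply: eqC; rewrite ?ReM ?ImM /=.
  rewrite -!RintegralZl// -RintegralB//.
  by apply: eq_Rintegral => x _; rewrite ReM.
rewrite -!RintegralZl// -RintegralD//.
by apply: eq_Rintegral => x _; rewrite ImM.
Qed.

Lemma eq_Cint f g : {in D, f =1 g} -> Cint D f = Cint D g.
Proof.
move=> fg; rewrite /Cint; congr (_ +i* _);
  by apply: eq_Rintegral => x xD; rewrite fg.
Qed.

Lemma Cint0 : Cint D (fun=> 0) = 0.
Proof. by rewrite /Cint /Rintegral integral0. Qed.

Lemma Cintg_sum I (r : seq I) (F : I -> T -> R[i]) :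
  (forall i, Cintg D (F i)) -> Cintg D (fun x => \sum_(i <- r) F i x).
Proof.
move=> mF; elim: r => [|a r IHr].
  by under eq_fun do rewrite big_nil; exact: Cintg0.
by under eq_fun do rewrite big_cons; exact: CintgD.
Qed.

Lemma Cint_sum I (r : seq I) (F : I -> T -> R[i]) :
  (forall i, Cintg D (F i)) ->
  Cint D (fun x => \sum_(i <- r) F i x) = \sum_(i <- r) Cint D (F i).
Proof.
move=> mF; elim: r => [|a r IHr].
  by under eq_fun do rewrite big_nil; rewrite big_nil Cint0.
under eq_fun do rewrite big_cons; rewrite big_cons CintD ?IHr//.
exact: Cintg_sum.
Qed.

Lemma Cint_real (f : T -> R) :
  Cint D (fun x => (f x)%:C) = (\int[mu]_(x in D) f x)%:C.
Proof. by rewrite /Cint /= {2}/Rintegral integral0. Qed.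

(** Real and imaginary parts are bounded separately, whence the factor 2; only orders of magnitude
    matter below. *)
Lemma normc_Cint_le f : Cintg D f ->
  normc (Cint D f) <= 2 * \int[mu]_(x in D) normc (f x).
Proof.
move=> if_; have [f1 f2] := if_; have nf := Cintg_normc if_.
rewrite (le_trans (normc_le_ReIm _))//= mulr_natl mulr2n.
have a1 : mu.-integrable D (EFin \o (fun x => `|Re (f x)|)) := integrable_abse f1.
have a2 : mu.-integrable D (EFin \o (fun x => `|Im (f x)|)) := integrable_abse f2.
apply: lerD.
  apply: le_trans (le_normr_Rintegral mD f1) _.
  by apply: le_Rintegral => // x _; exact: le_Re_normc.
apply: le_trans (le_normr_Rintegral mD f2) _.
by apply: le_Rintegral => // x _; exact: le_Im_normc.
Qed.

End measurable_domain.
End complex_integral.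

(** * Fubini's theorem and product functions *)

Section fubini.
Context d1 d2 (T1 : measurableType d1) (T2 : measurableType d2) (R : realType).
Variable m1 : {sigma_finite_measure set T1 -> \bar R}.
Variable m2 : {sigma_finite_measure set T2 -> \bar R}.

(** Integrability is required of every slice, not almost every one, so that the inner integrals are
    finite everywhere and taking [fine] of them loses nothing. *)
Lemma Cint_fubini1 (F : T1 * T2 -> R[i]) :
  Cintg (m1 \x m2)%E setT F -> (forall x, Cintg m2 setT (fun y => F (x, y))) ->
  Cintg m1 setT (fun x => Cint m2 setT (fun y => F (x, y))) /\
  Cint (m1 \x m2)%E setT F = Cint m1 setT (fun x => Cint m2 setT (fun y => F (x, y))).
Proof.
move=> [F1 F2] Fx.
have E1 : fubini_F m2 (fun z => (Re (F z))%:E) =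
    (fun x => (Re (Cint m2 setT (fun y => F (x, y))))%:E).
  by apply/funext => x; rewrite /fubini_F /= fineK//; apply: integrable_fin_num => //;
    have [] := Fx x.
have E2 : fubini_F m2 (fun z => (Im (F z))%:E) =
    (fun x => (Im (Cint m2 setT (fun y => F (x, y))))%:E).
  by apply/funext => x; rewrite /fubini_F /= fineK//; apply: integrable_fin_num => //;
    have [] := Fx x.
split.
  split; first by rewrite -E1; exact: integrable_fubini_F.
  by rewrite -E2; exact: integrable_fubini_F.
rewrite {1 2}/Cint /Rintegral; congr (fine _ +i* fine _).
  by rewrite -integral12_prod_meas1//; apply: eq_integral => x _; exact: (congr1 (@^~ x) E1).
by rewrite -integral12_prod_meas1//; apply: eq_integral => x _; exact: (congr1 (@^~ x) E2).
Qed.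

Lemma Cint_fubini2 (F : T1 * T2 -> R[i]) :
  Cintg (m1 \x m2)%E setT F -> (forall y, Cintg m1 setT (fun x => F (x, y))) ->
  Cint (m1 \x m2)%E setT F = Cint m2 setT (fun y => Cint m1 setT (fun x => F (x, y))).
Proof.
move=> [F1 F2] Fx.
have E1 : fubini_G m1 (fun z => (Re (F z))%:E) =
    (fun y => (Re (Cint m1 setT (fun x => F (x, y))))%:E).
  by apply/funext => x; rewrite /fubini_G /= fineK//; apply: integrable_fin_num => //;
    have [] := Fx x.
have E2 : fubini_G m1 (fun z => (Im (F z))%:E) =
    (fun y => (Im (Cint m1 setT (fun x => F (x, y))))%:E).
  by apply/funext => x; rewrite /fubini_G /= fineK//; apply: integrable_fin_num => //;
    have [] := Fx x.
rewrite {1 2}/Cint /Rintegral; congr (fine _ +i* fine _).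
  by rewrite -integral21_prod_meas1//; apply: eq_integral => x _; exact: (congr1 (@^~ x) E1).
by rewrite -integral21_prod_meas1//; apply: eq_integral => x _; exact: (congr1 (@^~ x) E2).
Qed.

Lemma integrable_tensor (f : T1 -> R) (g : T2 -> R) :
  m1.-integrable setT (EFin \o f) -> m2.-integrable setT (EFin \o g) ->
  (m1 \x m2)%E.-integrable setT (fun z => (f z.1 * g z.2)%:E).
Proof.
move=> if_ ig.
have mf : measurable_fun setT f by apply/measurable_EFinP; exact: measurable_int if_.
have mg : measurable_fun setT g by apply/measurable_EFinP; exact: measurable_int ig.
apply/integrable12ltyP.
  apply/measurable_EFinP; apply: measurable_funM.
    exact: measurableT_comp mf (measurable_fst).
  exact: measurableT_comp mg (measurable_snd).
have /integrableP[_ Ig] := ig; have /integrableP[_ If] := if_.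
under eq_integral => x _.
  under eq_integral => y _ do rewrite /= normrM EFinM.
  rewrite ge0_integralZl//=; last by apply/measurable_EFinP; exact: measurableT_comp.
  over.
rewrite ge0_integralZr//=.
- by rewrite lte_mul_pinfty// ?integral_ge0// ge0_fin_numE ?integral_ge0.
- by apply/measurable_EFinP; exact: measurableT_comp.
- exact: integral_ge0.
Qed.

Lemma CintgM_tensor (A : T1 -> R[i]) (B : T2 -> R[i]) (E : T1 * T2 -> R[i]) :
  Cintg m1 setT A -> Cintg m2 setT B -> Cmeas setT E ->
  (forall z, normc (E z) <= 1) ->
  Cintg (m1 \x m2)%E setT (fun z => A z.1 * B z.2 * E z).
Proof.
move=> iA iB mE E1.
have [A1 A2] := Cintg_meas iA; have [B1 B2] := Cintg_meas iB.
have iAB := integrable_tensor (Cintg_normc measurableT iA) (Cintg_normc measurableT iB).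
apply: (Cintg_dom measurableT) iAB _.
  apply: CmeasM => //; apply: CmeasM; split.
  - exact: measurableT_comp A1 measurable_fst.
  - exact: measurableT_comp A2 measurable_fst.
  - exact: measurableT_comp B1 measurable_snd.
  - exact: measurableT_comp B2 measurable_snd.
move=> z _; rewrite !ComplexField.Normc.normcM ler_piMr// mulr_ge0//; exact: normc_ge0.
Qed.

Lemma Cint_tensor (A : T1 -> R[i]) (B : T2 -> R[i]) :
  Cintg m1 setT A -> Cintg m2 setT B ->
  Cintg (m1 \x m2)%E setT (fun z => A z.1 * B z.2) /\
  Cint (m1 \x m2)%E setT (fun z => A z.1 * B z.2) = Cint m1 setT A * Cint m2 setT B.
Proof.
move=> iA iB.
have iAB : Cintg (m1 \x m2)%E setT (fun z => A z.1 * B z.2).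
  have := @CintgM_tensor A B (fun=> 1) iA iB (Cmeas_cst _ _).
  under eq_fun do rewrite mulr1; apply => _.
  by rewrite ComplexField.Normc.normc1.
split => //; have [_ ->] := Cint_fubini1 iAB (fun x => CintgZ measurableT (A x) iB).
rewrite mulrC -CintZ//; apply: eq_Cint => x _.
by rewrite /= CintZ// mulrC.
Qed.

End fubini.

Section rV.
Context {R : realType}.

Lemma measurable_rV_coord n (i : 'I_n) :
  measurable_fun [set: 'rV[R]_n] (fun x => x ord0 i).
Proof. exact: measurable_coord. Qed.

Lemma rV_consS n (p : measurableTypeR R * 'rV[R]_n) (i : 'I_n) :
  rV_cons p ord0 (lift ord0 i) = p.2 ord0 i.
Proof.
rewrite (_ : lift ord0 i = rshift 1 i); last exact/val_inj.
by rewrite /rV_cons [LHS](row_mxEr (p.1 : R)%:M).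
Qed.

(** [lebesgue_rV n.+1] is by construction the image of the product measure under [rV_cons], so this
    is the change of variables for an image measure. *)
Lemma Cint_rVS n (f : 'rV[R]_n.+1 -> R[i]) : Cmeas setT f ->
  Cintg (lebesgue_measure \x lebesgue_rV n)%E setT (f \o @rV_cons R n) ->
  Cintg (lebesgue_rV n.+1) setT f /\
  Cint (lebesgue_rV n.+1) setT f =
  Cint (lebesgue_measure \x lebesgue_rV n)%E setT (f \o @rV_cons R n).
Proof.
move=> [mf1 mf2] [if1 if2].
have e1 : measurable_fun setT (fun x => (Re (f x))%:E) by exact/measurable_EFinP.
have e2 : measurable_fun setT (fun x => (Im (f x))%:E) by exact/measurable_EFinP.
have m := @measurable_rV_cons R n.
split; [split|].
- exact: (integrable_pushforward m e1 if1).
- exact: (integrable_pushforward m e2 if2).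
- rewrite /Cint /Rintegral; congr (fine _ +i* fine _).
  + exact: (integral_pushforward m e1 if1).
  + exact: (integral_pushforward m e2 if2).
Qed.

Lemma Cint_rV_prod n (a : 'I_n -> R -> R[i]) :
  (forall i, Cintg (@lebesgue_measure R) setT (a i)) ->
  Cintg (lebesgue_rV n) setT (fun x => \prod_(i < n) a i (x ord0 i)) /\
  Cint (lebesgue_rV n) setT (fun x => \prod_(i < n) a i (x ord0 i)) =
  \prod_(i < n) Cint (@lebesgue_measure R) setT (a i).
Proof.
elim: n a => [|n IHn] a ia.
  under [in X in X /\ _]eq_fun do rewrite big_ord0.
  under [in X in _ /\ X]eq_fun do rewrite big_ord0.
  rewrite big_ord0; split.
    split => /=; apply/integrableP; split => //.
      by rewrite integral_dirac//= diracE mem_setT normr1 mul1e ltry.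
    by rewrite integral_dirac//= diracE mem_setT normr0 mule0 ltry.
  by apply: eqC; rewrite /= /Rintegral integral_dirac//= ?mulr0 // mulr1 indicE mem_setT.
have [i1 e1] := IHn (fun i => a (lift ord0 i)) (fun i => ia _).
have [i2 e2] := Cint_tensor (m1 := lebesgue_measure) (m2 := lebesgue_rV n) (ia ord0) i1.
have E : (fun x : 'rV[R]_n.+1 => \prod_(i < n.+1) a i (x ord0 i)) \o @rV_cons R n =
   (fun z => a ord0 z.1 * \prod_(i < n) a (lift ord0 i) (z.2 ord0 i)).
  apply/funext => z /=; rewrite big_ord_recl rV_cons0; congr (_ * _).
  by apply: eq_bigr => i _; rewrite rV_consS.
have [||i3 e3] := @Cint_rVS n (fun x : 'rV[R]_n.+1 => \prod_(i < n.+1) a i (x ord0 i)).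
- apply: Cmeas_prod => i; have [m1 m2] := Cintg_meas (ia i).
  by split; [exact: measurableT_comp m1 (@measurable_coord _ _ _)|
             exact: measurableT_comp m2 (@measurable_coord _ _ _)].
- by rewrite E.
by split => //; rewrite e3 E e2 e1 big_ord_recl.
Qed.

Lemma Rint_rV_prod n (a : 'I_n -> R -> R) :
  (forall i, (@lebesgue_measure R).-integrable setT (EFin \o a i)) ->
  (lebesgue_rV n).-integrable setT (fun x => (\prod_(i < n) a i (x ord0 i))%:E) /\
  \int[lebesgue_rV n]_x (\prod_(i < n) a i (x ord0 i)) =
  \prod_(i < n) \int[@lebesgue_measure R]_x a i x.
Proof.
move=> ia.
have [|[i1 _] e] := @Cint_rV_prod n (fun i x => (a i x)%:C).
  by move=> i; split; [exact: ia|exact: integrable0].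
have E (x : 'rV[R]_n) : \prod_(i < n) (a i (x ord0 i))%:C = (\prod_(i < n) a i (x ord0 i))%:C.
  by rewrite rmorph_prod.
split.
  by under eq_fun do rewrite -[X in X%:E]/(Re (_%:C)) -E.
apply: complexI; rewrite -Cint_real rmorph_prod /=.
under eq_Cint do rewrite -E.
by rewrite e; apply: eq_bigr => i _; rewrite Cint_real.
Qed.

End rV.

(** * Borel sets of the space of row vectors *)

Section borel.
Context {R : realType} (n : nat).

Lemma measurable_rV_box (A : 'I_n -> set R) :
  (forall i, measurable (A i : set (measurableTypeR R))) ->
  measurable [set x : 'rV[R]_n | forall i, A i (x ord0 i)].
Proof.
move=> mA.
rewrite (_ : [set _ | _] =
    \bigcap_(i in [set: 'I_n]) ((fun x : 'rV[R]_n => x ord0 i) @^-1` A i)); last first.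
  by apply/seteqP; split=> x /= h i; [move=> _|]; exact: h.
apply: fin_bigcap_measurable => // i _.
by rewrite -[X in measurable X]setTI; apply: measurable_rV_coord => //; exact: mA.
Qed.

(** The sigma-algebra is generated by the coordinates, so an open set is written as the countable
    union of the rational boxes that it contains. *)
Lemma open_measurable_rV (U : set 'rV[R]_n) : open U -> measurable U.
Proof.
move=> oU.
pose B (p : 'rV[rat]_n * rat) : set 'rV[R]_n :=
  [set x | forall i, [set` `]ratr (p.1 ord0 i) - ratr p.2, ratr (p.1 ord0 i) +
    ratr p.2[] (x ord0 i)].
pose F p := if `[< B p `<=` U >] then B p else set0.
rewrite (_ : U = \bigcup_p F p); last first.
  apply/seteqP; split => [x Ux|x [p _]]; last first.
    by rewrite /F; case: asboolP => // + Bx; apply.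
  have /nbhs_ballP[e /= e0 xeU] : nbhs x U by apply: open_nbhs_nbhs; split.
  have [d] := @rat_in_itvoo R 0 (e / 2) (divr_gt0 e0 (ltr0Sn _ 1)).
  rewrite in_itv/= => /andP[d0 de].
  have H i : exists q : rat, `|x ord0 i - ratr q| < ratr d.
    have [|q] := @rat_in_itvoo R (x ord0 i - ratr d) (x ord0 i + ratr d); first lra.
    by rewrite in_itv/= => /andP[h1 h2]; exists q; rewrite ltr_norml; apply/andP; split; lra.
  have [q Hq] := choice H.
  pose p := (\row_i q i, d).
  have Bx : B p x.
    by move=> i /=; rewrite mxE in_itv/=; move: (Hq i); rewrite ltr_norml => /andP[h1 h2];
      apply/andP; split; lra.
  exists p => //; rewrite /F; case: asboolP => // -[] y By; apply: xeU.
  split => // i j; rewrite (ord1 i) /ball /=.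
  have := By j; rewrite /= mxE in_itv/=; move: (Hq j);
    rewrite !ltr_norml => /andP[h1 h2] /andP[h3 h4].
  by apply/andP; split; lra.
apply: countable_bigcupT_measurable; first exact: countableP.
move=> p; rewrite /F; case: asboolP => _; last exact: measurable0.
apply: (measurable_rV_box (A := fun i =>
  [set` `]ratr (p.1 ord0 i) - ratr p.2, ratr (p.1 ord0 i) + ratr p.2[])) => i.
exact: measurable_itv.
Qed.

Lemma continuous_measurable_rV (f : 'rV[R]_n -> R) :
  continuous f -> measurable_fun setT f.
Proof.
move=> /continuousP cf; apply: (measurability _ (RGenOpens.measurableE R)).
move=> _ [_ [a [b ->] <-]]; rewrite setTI; apply: open_measurable_rV.
by apply: cf; exact: interval_open.
Qed.

End borel.

(** * Integrals on the line *)

Section line_integrals.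
Context {R : realType}.
Notation leb := (@lebesgue_measure R).
Implicit Types (G : R -> R) (a x xi : R).

Lemma ge0_integral_shift G a : continuous G -> (forall x, 0 <= G x) ->
  (\int[leb]_x (G x)%:E = \int[leb]_x (G (x - a))%:E)%E.
Proof.
move=> cG G0.
have dF : (fun x : R => x - a)^`()%classic = cst 1.
  by apply/funext => x; rewrite derive1E derive_val ?subr0 ?oppr0 ?addr0.
rewrite (@increasing_ge0_integration_by_substitutionT _ (fun x => x - a) G)//.
- by apply: eq_integral => x _; rewrite dF /= /cst /=; congr (_%:E); rewrite [LHS]mulr1.
- by move=> x y; rewrite ltrD2r.
- by rewrite dF; exact: cst_continuous.
- by rewrite dF; exact: is_cvg_cst.
- by rewrite dF; exact: is_cvg_cst.
- apply/cvgrNyPle => A; exists (A + a); split; first exact: num_real.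
  by move=> x /ltW h; rewrite lerBlDr.
- apply/cvgryPge => A; exists (A + a); split; first exact: num_real.
  by move=> x /ltW h; rewrite lerBrDr.
Qed.

Lemma integrable_shift G a : continuous G -> (forall x, 0 <= G x) ->
  leb.-integrable setT (EFin \o G) ->
  leb.-integrable setT (EFin \o (fun x => G (x - a))) /\
  \int[leb]_x G (x - a) = \int[leb]_x G x.
Proof.
move=> cG G0 /integrableP[_ iG]; split; last first.
  by congr fine; exact/esym/ge0_integral_shift.
apply/integrableP; split.
  apply/measurable_EFinP; apply: continuous_measurable_fun => x.
  by apply: continuous_comp; [apply: continuousD; [exact: cvg_id|exact: cst_continuous]|exact: cG].
under eq_integral do rewrite /= ger0_norm//.
rewrite -ge0_integral_shift//.
by move: iG; under eq_integral do rewrite /= ger0_norm//.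
Qed.

Definition inv1sqr x : R := (1 + x ^+ 2)^-1.

Lemma inv1sqr_gt0 x : 0 < inv1sqr x.
Proof. by rewrite invr_gt0 ltr_pwDl// sqr_ge0. Qed.

Lemma inv1sqr_le1 x : inv1sqr x <= 1.
Proof. by rewrite invf_le1 ?lerDl ?sqr_ge0// ltr_pwDl// sqr_ge0. Qed.

Lemma continuous_inv1sqr : continuous inv1sqr.
Proof.
move=> x; apply: (@continuousV _ _ (fun x => 1 + x ^+ 2)).
  by rewrite gt_eqF// ltr_pwDl// sqr_ge0.
by apply: continuousD; [exact: cst_continuous|exact: exprn_continuous].
Qed.

Lemma integral_inv1sqr : (\int[leb]_x (inv1sqr x)%:E = pi%:E)%E.
Proof.
rewrite ge0_symfun_integralT; last 3 first.
- by move=> x; exact/ltW/inv1sqr_gt0.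
- exact: continuous_inv1sqr.
- by move=> x /=; rewrite /inv1sqr sqrrN.
rewrite -set_itvcy (@ge0_continuous_FTC2y _ _ atan _ (pi / 2)).
- by rewrite atan0 sube0 -EFinM; congr _%:E; field.
- by move=> x _; exact/ltW/inv1sqr_gt0.
- by apply: continuous_subspaceT; exact: continuous_inv1sqr.
- exact: cvgy_atan.
- by move=> x _; exact: derivable_atan.
- by apply: cvg_at_right_filter; exact: continuous_atan.
- by move=> x _; rewrite derive1_atan.
Qed.

Lemma integrable_inv1sqr : leb.-integrable setT (EFin \o inv1sqr).
Proof.
apply/integrableP; split.
  by apply/measurable_EFinP; apply: continuous_measurable_fun; exact: continuous_inv1sqr.
under eq_integral do rewrite /= ger0_norm ?(ltW (inv1sqr_gt0 _))//.
by rewrite integral_inv1sqr ltry.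
Qed.

Lemma continuous_sqr_inv1sqr : continuous (fun x => inv1sqr x ^+ 2).
Proof.
move=> x; apply: (continuous_comp (f := inv1sqr) (g := fun y => y ^+ 2)).
  exact: continuous_inv1sqr.
exact: exprn_continuous.
Qed.

Lemma integrable_sqr_inv1sqr :
  leb.-integrable setT (EFin \o (fun x => inv1sqr x ^+ 2)).
Proof.
apply: (le_integrable measurableT) integrable_inv1sqr.
  by apply/measurable_EFinP; apply: continuous_measurable_fun; exact: continuous_sqr_inv1sqr.
move=> x _ /=; have h := inv1sqr_gt0 x.
by rewrite lee_fin !ger0_norm ?sqr_ge0 ?(ltW h)// expr2 ler_piMl ?(ltW h)// inv1sqr_le1.
Qed.

Lemma integral_sqr_inv1sqr_gt0 : 0 < \int[leb]_x (inv1sqr x ^+ 2).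
Proof.
have m1 : measurable_fun setT (EFin \o (fun x =>
  inv1sqr x ^+ 2)) by exact: measurable_int integrable_sqr_inv1sqr.
have f1 := integrable_fin_num measurableT integrable_sqr_inv1sqr.
(* Only positivity is needed: on [[0, 1]] the integrand is at least 1/4. *)
apply: (@lt_le_trans _ _ (4^-1 * 1)); first by rewrite mulr1 invr_gt0.
rewrite -lee_fin /Rintegral fineK//.
have -> : ((4^-1 * 1)%:E = \int[leb]_(x in `[0%R, 1%R]) (cst (4^-1)%:E x))%E.
  by rewrite integral_cst//= lebesgue_measure_itv/= lte01 oppr0 adde0 EFinM.
apply: (@le_trans _ _ (\int[leb]_(x in `[0%R, 1%R]) (inv1sqr x ^+ 2)%:E)%E).
  apply: ge0_le_integral => //=.
  - exact: (measurable_funTS m1).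
  - move=> x; rewrite in_itv/= => /andP[x0 x1]; rewrite lee_fin.
    rewrite /inv1sqr exprVn lef_pV2 ?posrE ?exprn_gt0 ?ltr_pwDl ?sqr_ge0//.
    rewrite (_ : 4 = 2 ^+ 2) ?lerXn2r ?nnegrE ?addr_ge0 ?sqr_ge0//; last by rewrite -natrX.
    by rewrite (_ : 2 = 1 + 1 :> R)// lerD2l expr_le1.
apply: ge0_subset_integral => //=.
by move=> x _; rewrite lee_fin sqr_ge0.
Qed.

End line_integrals.

(** * An explicit Fourier transform on the line *)

Section exponential_fourier.
Context {R : realType}.
Notation leb := (@lebesgue_measure R).
Implicit Types (x xi : R).

(** This is the convolution square of [exp (- |x|) / 2], whose transform is [inv1sqr]; hence its own
    transform is [inv1sqr ^ 2] and its integral is 1. *)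
Definition exp_tent x : R := (1 + `|x|) * expR (- `|x|) / 4.

(* A primitive of [(1 + x) exp (- x) cos (x xi)]. *)
Definition exp_tent_primitive xi x : R := expR (- x) *
  ((- inv1sqr xi * x - inv1sqr xi - 1 + xi ^+ 2 * (2 * inv1sqr xi +
    1) * inv1sqr xi) * cos (x * xi) +
   (xi * inv1sqr xi * x + xi * (2 * inv1sqr xi + 1) * inv1sqr xi) * sin (x * xi)).
Local Notation P := exp_tent_primitive.

Lemma inv1sqrE xi : inv1sqr xi * (1 + xi ^+ 2) = 1.
Proof. by rewrite mulVf// gt_eqF// ltr_pwDl// sqr_ge0. Qed.

Lemma is_derive_exp_tent_primitive xi x :
  is_derive x 1 (P xi) ((1 + x) * expR (- x) * cos (x * xi)).
Proof.
apply: is_derive_eq; rewrite /GRing.scale /=; have := inv1sqrE xi.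
set D := inv1sqr xi; set e := expR _; set c := cos _; set s := sin _ => hD.
(* The computed derivative differs from the expected one by a multiple of [D (1 + xi ^ 2) - 1],
   which vanishes. *)
transitivity ((1 + x) * e * c +
  (D * (1 + xi ^+ 2) - 1) * (e * (x * c - xi * (2 * D + 1) * s))); first by ring.
by rewrite hD subrr mul0r addr0.
Qed.

Lemma exp_tent_primitive0 xi : P xi 0 = - (2 * inv1sqr xi ^+ 2).
Proof.
rewrite /P oppr0 expR0 mul0r cos0 sin0; have := inv1sqrE xi.
set D := inv1sqr xi => hD.
transitivity (- (2 * D ^+ 2) + (D * (1 + xi ^+ 2) - 1) * (2 * D + 1)); first by ring.
by rewrite hD subrr mul0r addr0.
Qed.

Lemma exp_tent_primitive_cvg xi : P xi x @[x --> +oo] --> (0 : R).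
Proof.
pose K := `|inv1sqr xi| + `|- inv1sqr xi - 1 + xi ^+ 2 * (2 * inv1sqr xi + 1) * inv1sqr xi| +
  `|xi * inv1sqr xi| + `|xi * (2 * inv1sqr xi + 1) * inv1sqr xi| + 1.
have K0 : 0 < K by rewrite ltr_wpDl// !addr_ge0.
have Px x : 0 < x -> `|P xi x| <= 4 * K / x.
  move=> x0; have ex : 0 < expR (- x) := expR_gt0 _.
  have h1 : `|P xi x| <= expR (- x) * (K * (1 + x)).
    rewrite /P normrM (ger0_norm (ltW ex)) ler_pM2l//.
    apply: le_trans (ler_normD _ _) _; rewrite !normrM.
    have c1 : `|cos (x * xi)| <= 1 by rewrite ler_norml cos_geN1 cos_le1.
    have s1 : `|sin (x * xi)| <= 1 by rewrite ler_norml sin_geN1 sin_le1.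
    apply: (@le_trans _ _ (`|- inv1sqr xi * x - inv1sqr xi - 1 + xi ^+ 2 * (2 * inv1sqr xi +
      1) * inv1sqr xi| +
       `|xi * inv1sqr xi * x + xi * (2 * inv1sqr xi + 1) * inv1sqr xi|)).
      by apply: lerD; exact: ler_piMr.
    rewrite -[- _ * x - _ - 1 + _](_ : - inv1sqr xi * x + (- inv1sqr xi - 1 +
      xi ^+ 2 * (2 * inv1sqr xi + 1) * inv1sqr xi) = _); last by ring.
    apply: le_trans (lerD (ler_normD _ _) (ler_normD _ _)) _.
    rewrite 2!(normrM _ x) normrN (gtr0_norm x0) /K.
    move: (`|_ - 1 + _|) (normr_ge0 (- inv1sqr xi - 1 + xi ^+ 2 * (2 * inv1sqr xi +
      1) * inv1sqr xi)) => a a0.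
    move: (`|inv1sqr xi|) (normr_ge0 (inv1sqr xi)) => b b0.
    move: (`|xi * inv1sqr xi|) (normr_ge0 (xi * inv1sqr xi)) => c c0.
    move: (`|_ * _|) (normr_ge0 (xi * (2 * inv1sqr xi + 1) * inv1sqr xi)) => d d0.
    nra.
  apply: le_trans h1 _.
  (* Squaring [1 + x / 2 <= exp (x / 2)] gives quadratic growth, enough to beat the linear factor
     [1 + x]. *)
  have e2 : (1 + x / 2) ^+ 2 <= expR x.
    rewrite [in leRHS](_ : x = x / 2 + x / 2); last by field.
    by rewrite expRD -expr2 lerXn2r ?nnegrE ?expR_ge0 ?expR_ge1Dx//; lra.
  rewrite expRN mulrC ler_pdivrMr ?expR_gt0// mulrAC ler_pdivlMr//.
  apply: le_trans (_ : 4 * K * (1 + x / 2) ^+ 2 <= _); first nra.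
  by rewrite ler_pM2l//; lra.
apply/cvgrPdist_le => e e0; exists (4 * K / e); split; first exact: num_real.
move=> x Kx; have x0 : 0 < x by apply: lt_trans Kx; rewrite divr_gt0// mulr_gt0.
rewrite /= sub0r normrN (le_trans (Px _ x0))//.
by rewrite ler_pdivrMr// [leRHS]mulrC -ler_pdivrMr// ltW.
Qed.

Lemma exp_tent_ge0 x : 0 <= exp_tent x.
Proof. by rewrite /exp_tent !mulr_ge0// ?addr_ge0 ?expR_ge0. Qed.

Lemma continuous_exp_tent : continuous exp_tent.
Proof.
move=> x; apply: cvgM; last exact: cvg_cst.
apply: cvgM; first by apply: cvgD; [exact: cvg_cst|exact: norm_continuous].
apply: continuous_comp; last exact: continuous_expR.
by apply: cvgN; exact: norm_continuous.
Qed.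

Lemma continuous_mul xi : continuous (fun x => x * xi).
Proof. by move=> x; apply: cvgM; [exact: cvg_id|exact: cvg_cst]. Qed.

(** Adding 1 to the cosine makes the integrand nonnegative, so the fundamental theorem on a
    half-line applies before integrability is known. The case [xi = 0] then gives the mass of
    [exp_tent], and subtracting that mass leaves the cosine transform. *)
Lemma integral_exp_tent_1Dcos xi :
  (\int[leb]_x (exp_tent x * (1 + cos (x * xi)))%:E = (1 + inv1sqr xi ^+ 2)%:E)%E.
Proof.
have ccos : continuous (fun x => cos (x * xi)).
  by move=> x; apply: continuous_comp; [exact: continuous_mul|exact: continuous_cos].
have c1 : continuous (fun x => 1 + cos (x * xi)).
  by move=> x; apply: cvgD; [exact: cvg_cst|exact: ccos].
rewrite ge0_symfun_integralT; last 3 first.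
- by move=> x; apply: mulr_ge0 (exp_tent_ge0 x) _; have := cos_geN1 (x * xi); lra.
- by move=> x; apply: cvgM; [exact: continuous_exp_tent|exact: c1].
- by move=> x /=; rewrite /exp_tent normrN mulNr cosN.
pose f x : R := (1 + x) * expR (- x) * (1 + cos (x * xi)) / 4.
rewrite -set_itvcy.
rewrite (_ : (\int[leb]_(x in _) _)%E = (\int[leb]_(x in `[0%R, +oo[) (f x)%:E)%E); last first.
  apply: eq_integral => x; rewrite inE/= in_itv/= andbT => x0.
  by rewrite /exp_tent ger0_norm// /f; congr _%:E; ring.
have dF x : is_derive x 1 (fun x => (P xi x + P 0 x) / 4) (f x).
  have h1 := is_derive_exp_tent_primitive xi x.
  have h2 := is_derive_exp_tent_primitive 0 x.
  apply: is_derive_eq; rewrite /f mulr0 cos0 /GRing.scale /= ; ring.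
rewrite (@ge0_continuous_FTC2y _ _ (fun x => (P xi x + P 0 x) / 4) _ 0).
- rewrite !exp_tent_primitive0 sub0e -EFinN -EFinM; congr _%:E.
  rewrite (_ : inv1sqr 0 = 1); first by field.
  by rewrite /inv1sqr expr0n addr0 invr1.
- move=> x x0; have c0 : 0 <= 1 + cos (x * xi) by have := cos_geN1 (x * xi); lra.
  by rewrite /f !mulr_ge0// ?expR_ge0 ?addr_ge0.
- apply: continuous_subspaceT => x; apply: cvgM; last exact: cvg_cst.
  apply: cvgM; last exact: c1.
  apply: cvgM; first by apply: cvgD; [exact: cvg_cst|exact: cvg_id].
  apply: continuous_comp; last exact: continuous_expR.
  by apply: cvgN; exact: cvg_id.
- rewrite -[X in _ --> X](_ : (0 + 0) / 4 = 0 :> R); last by rewrite addr0 mul0r.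
  apply: cvgM; last exact: cvg_cst.
  by apply: cvgD; exact: exp_tent_primitive_cvg.
- by move=> x _; exact: (@ex_derive _ _ _ _ _ _ _ (dF x)).
- have d0 : derivable (fun x => (P xi x + P 0 x) / 4) 0 1.
    exact: (@ex_derive _ _ _ _ _ _ _ (dF 0)).
  have c0 : {for 0, continuous (fun x => (P xi x + P 0 x) / 4)}.
    by move/derivable1_diffP : d0 => /differentiable_continuous.
  exact: cvg_at_right_filter c0.
- by move=> x _; rewrite derive1E; exact: (@derive_val _ _ _ _ _ _ _ (dF x)).
Qed.

Lemma integral_exp_tent : (\int[leb]_x (exp_tent x)%:E = 1%:E)%E.
Proof.
have := integral_exp_tent_1Dcos 0.
under eq_integral => x _ do rewrite mulr0 cos0 mulrC EFinM.
rewrite ge0_integralZl//=.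
- rewrite (_ : inv1sqr 0 = 1); last by rewrite /inv1sqr expr0n addr0 invr1.
  rewrite expr1n; set I := (\int[_]_x _)%E.
  have : (0 <= I)%E by apply: integral_ge0 => x _; rewrite lee_fin exp_tent_ge0.
  case: I => [r| |] //= _; first by rewrite -EFinM => -[] h; congr _%:E; lra.
  by rewrite gt0_muley// lte_fin.
- apply/measurable_EFinP; apply: continuous_measurable_fun; exact: continuous_exp_tent.
- by move=> x _; rewrite lee_fin exp_tent_ge0.
Qed.

Lemma integrable_exp_tent : leb.-integrable setT (EFin \o exp_tent).
Proof.
apply/integrableP; split.
  by apply/measurable_EFinP; apply: continuous_measurable_fun; exact: continuous_exp_tent.
under eq_integral do rewrite /= ger0_norm ?exp_tent_ge0//.
by rewrite integral_exp_tent ltry.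
Qed.

Lemma Cintg_exp_tent xi :
  Cintg leb setT (fun x => (exp_tent x)%:C * cexpi (- (x * xi))).
Proof.
apply: (Cintg_dom measurableT) integrable_exp_tent _.
  apply: CmeasM; first by apply: Cmeas_real; apply: continuous_measurable_fun;
    exact: continuous_exp_tent.
  apply: Cmeas_cexpi; apply: continuous_measurable_fun => x.
  by apply: cvgN; exact: continuous_mul.
move=> x _; rewrite ComplexField.Normc.normcM normc_cexpi mulr1 normc_real.
by rewrite ger0_norm// exp_tent_ge0.
Qed.

Lemma fourier_exp_tent xi :
  Cint leb setT (fun x => (exp_tent x)%:C * cexpi (- (x * xi))) =
  (inv1sqr xi ^+ 2)%:C.
Proof.
have [] := Cintg_exp_tent xi => i1 i2.
have E1 x : Re ((exp_tent x)%:C * cexpi (- (x * xi))) = exp_tent x * cos (x * xi).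
  by rewrite /= cosN mul0r subr0.
have E2 x : Im ((exp_tent x)%:C * cexpi (- (x * xi))) = - (exp_tent x * sin (x * xi)).
  by rewrite /= sinN mul0r addr0 mulrN.
have it := integrable_exp_tent.
apply: eqC; rewrite /=.
  under eq_Rintegral do rewrite cosN mul0r subr0.
  have -> : inv1sqr xi ^+ 2 =
      \int[leb]_x (exp_tent x * (1 + cos (x * xi))) - \int[leb]_x exp_tent x.
    by rewrite /Rintegral integral_exp_tent_1Dcos integral_exp_tent /=; ring.
  rewrite -RintegralB//.
    by apply: eq_Rintegral => x _; rewrite mulrDr mulr1 addrC addKr.
  apply/integrableP; split.
    apply/measurable_EFinP/measurable_funM.
      by apply: continuous_measurable_fun; exact: continuous_exp_tent.
    apply: measurable_funD => //; apply: continuous_measurable_fun => x.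
    by apply: continuous_comp; [exact: continuous_mul|exact: continuous_cos].
  rewrite (_ : (\int[leb]_x _)%E =
      (\int[leb]_x (exp_tent x * (1 + cos (x * xi)))%:E)%E).
    by rewrite integral_exp_tent_1Dcos ltry.
  apply: eq_integral => x _ /=; rewrite ger0_norm//.
  by apply: mulr_ge0 (exp_tent_ge0 x) _; have := cos_geN1 (x * xi); lra.
(* The imaginary part is the integral of an odd function, and Lebesgue measure is invariant under
   reflection. *)
set f := fun x => _ : R.
have fN x : f (- x) = - f x.
  by rewrite /f /exp_tent normrN mulNr opprK sinN !mul0r !addr0 mulrN opprK.
suff : \int[leb]_x f x = - \int[leb]_x f x by move/eqP; rewrite -addr_eq0 -mulr2n mulrn_eq0 => /eqP.
have mf : measurable_fun setT (EFin \o f) by exact: measurable_int i2.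
have mN : measurable_fun setT (-%R : measurableTypeR R -> measurableTypeR R).
  exact: oppr_measurable.
rewrite -[in RHS]mulN1r -RintegralZl//.
rewrite [RHS](_ : _ = \int[leb]_x f (- x)); last first.
  by apply: eq_Rintegral => x _; rewrite fN mulN1r.
rewrite /Rintegral; congr fine.
transitivity (\int[pushforward leb (-%R : measurableTypeR R -> measurableTypeR R)]_x (f x)%:E)%E.
  by apply: eq_measure_integral => A mA _; apply/esym; exact: lebesgue_measureN.
rewrite (integral_pushforward mN mf)//=.
rewrite preimage_setT.
apply: eq_integrable (integrableZl measurableT (-1) i2) => // x _.
by rewrite /= fN EFinN mulN1e.
Qed.

End exponential_fourier.

(** * Smooth bump functions *)

Section flat_functions.
Context {R : realType}.
Implicit Types (p q : {poly R}) (y : R).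

(** The polynomial is carried along so that the family is stable under differentiation; [p = 1] is
    the classical flat function. *)
Definition flat p y : R := if 0 < y then p.[y^-1] * expR (- y^-1) else 0.

Lemma norm_horner_le p (z : R) : 1 <= z ->
  `|p.[z]| <= (\sum_(i < size p) `|p`_i|) * z ^+ size p.
Proof.
move=> z1; rewrite horner_coef mulr_suml (le_trans (ler_norm_sum _ _ _))//.
apply: ler_sum => i _; rewrite normrM ler_wpM2l// normrX (ger0_norm (le_trans ler01 z1)).
by rewrite ler_weXn2l// ltnW.
Qed.

(** The exponential of [1 / y] dominates two more powers of [1 / y] than [p] uses. A quadratic bound
    is what forces the derivative at 0 to vanish. *)
Lemma flat_le_sqr p : exists2 K, 0 <= K & forall y, `|y| <= 1 -> `|flat p y| <= K * y ^+ 2.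
Proof.
pose m := size p; pose S := \sum_(i < size p) `|p`_i|.
have S0 : 0 <= S by exact: sumr_ge0.
exists (S * m.+2`!%:R) => [|y y1]; first by rewrite mulr_ge0.
rewrite /flat; case: ifPn => y0; last by rewrite normr0 mulr_ge0 ?sqr_ge0// mulr_ge0.
have z1 : 1 <= y^-1 by rewrite invf_ge1//; move: y1; rewrite gtr0_norm.
have z0 : 0 < y^-1 by rewrite invr_gt0.
rewrite normrM (ger0_norm (expR_ge0 _)).
apply: (@le_trans _ _ (S * y^-1 ^+ m * expR (- y^-1))).
  by rewrite ler_wpM2r ?expR_ge0// norm_horner_le.
rewrite -!mulrA ler_wpM2l// expRN ler_pdivrMr ?expR_gt0//.
have := expR_ge1Dxn m.+1 (ltW z0); set e := expR _ => he.
have f0 : 0 < m.+2`!%:R :> R by rewrite ltr0n fact_gt0.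
have he' : y^-1 ^+ m.+2 <= m.+2`!%:R * e.
  rewrite -ler_pdivrMl// mulrC; apply: le_trans he; by rewrite lerDr.
apply: (@le_trans _ _ (y ^+ 2 * y^-1 ^+ m.+2)).
  by rewrite (exprD y^-1 2 m) mulrA -exprMn divff ?gt_eqF// expr1n mul1r.
rewrite [leRHS](_ : _ = y ^+ 2 * (m.+2`!%:R * e)); last by ring.
by rewrite ler_wpM2l ?sqr_ge0.
Qed.

(** With [z = 1 / y] the derivation is [- z ^ 2 d/dz], and it sends [p(z) exp (- z)] to
    [z ^ 2 (p(z) - p'(z)) exp (- z)]. *)
Lemma is_derive_flat p y :
  is_derive y 1 (flat p) (flat ('X^2 * (p - p^`())) y).
Proof.
have [y0|y0|->] := ltgtP y 0.
- have e : {near y, cst 0 =1 flat p}.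
    near=> z; rewrite /flat ltNge (_ : z <= 0)//.
    by near: z; apply: filterS (open_nbhs_nbhs (conj (@open_lt R 0) y0)) => z /ltW.
  apply: DeriveDef; first by apply: near_eq_derivable e _; exact: derivable_cst.
  by rewrite -(near_eq_derive _ e) ?oner_eq0// derive_cst /flat ltNge (ltW y0).
- have e : {near y, (fun y => p.[y^-1] * expR (- y^-1)) =1 flat p}.
    near=> z; rewrite /flat ifT//.
    by near: z; exact: (open_nbhs_nbhs (conj (@open_gt R 0) y0)).
  have yN0 : y != 0 by rewrite gt_eqF.
  have dV : is_derive y 1 (fun y : R => y^-1) (- y ^- 2).
    have := @is_deriveV R id y 1 1 yN0 (is_derive_id _ _).
    by rewrite /GRing.scale /= mulr1.
  have d : is_derive y 1 (fun y => p.[y^-1] * expR (- y^-1)) (flat ('X^2 * (p - p^`())) y).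
    apply: is_derive_eq; rewrite /flat y0 !hornerE /GRing.scale /= -exprVn; ring.
  apply: DeriveDef; first by apply: near_eq_derivable e _; exact: ex_derive.
  by rewrite -(near_eq_derive _ e) ?oner_eq0// derive_val.
- rewrite [X in is_derive _ _ _ X](_ : _ = 0); last by rewrite /flat ltxx.
  have [K K0 HK] := flat_le_sqr p.
  have h : h^-1 *: (flat p (h *: 1 + 0) - flat p 0) @[h --> 0^'] --> (0 : R).
    apply/cvgrPdist_le => e e0; near=> h.
    have h0 : h != 0 by near: h; exact: nbhs_dnbhs_neq.
    rewrite sub0r normrN [flat p 0]/flat ltxx subr0 addr0 /GRing.scale /= mulr1.
    rewrite normrM normfV ler_pdivrMl ?normr_gt0//.
    have h1 : `|h| <= 1 by near: h; exact: dnbhs0_le.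
    have h2 : `|h| <= e / (K + 1) by near: h; apply: dnbhs0_le; rewrite divr_gt0// ltr_wpDl.
    apply: le_trans (HK _ h1) _; rewrite -[h ^+ 2]real_normK ?num_real//.
    have h3 : `|h| * (K + 1) <= e by rewrite -ler_pdivlMr// ltr_wpDl.
    rewrite expr2 mulrCA ler_wpM2l// (le_trans _ h3)// mulrC ler_wpM2l//.
    by rewrite lerDl.
  by apply: DeriveDef; [exact: (cvgP _ h)|exact: (cvg_lim _ h)].
Unshelve. all: by end_near. Qed.

Lemma flat_differentiable p y : differentiable (flat p) y.
Proof. by apply/derivable1_diffP; exact: (@ex_derive _ _ _ _ _ _ _ (is_derive_flat p y)). Qed.

End flat_functions.

Section bump_algebra.
Context {R : realType} {n : nat}.

(** An algebra of differentiable functions closed under every directional derivative: membership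
    yields smoothness at once, without formulas for the iterated partial derivatives. *)
Inductive bump_alg : ('rV[R]_n -> R) -> Prop :=
| bump_cst c : bump_alg (cst c)
| bump_flat p i c d : bump_alg (fun x => flat p (c * x ord0 i + d))
| bumpD f g : bump_alg f -> bump_alg g -> bump_alg (f \+ g)
| bumpM f g : bump_alg f -> bump_alg g -> bump_alg (f \* g).

Lemma affine_coord_diff (i : 'I_n) (c d : R) (x : 'rV[R]_n) :
  differentiable (fun x : 'rV[R]_n => c * x ord0 i + d) x.
Proof.
apply: differentiableD; last exact: differentiable_cst.
by apply: differentiableM; [exact: differentiable_cst|exact: differentiable_coord].
Qed.

Lemma derive_affine_coord (i : 'I_n) (c d : R) (x v : 'rV[R]_n) :
  'D_v (fun x : 'rV[R]_n => c * x ord0 i + d) x = c * v ord0 i.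
Proof.
apply: cvg_lim => //; apply: cvg_near_cst.
near=> h; have h0 : h != 0 by near: h; exact: nbhs_dnbhs_neq.
rewrite /GRing.scale /= !mxE; field.
by [].
Unshelve. all: by end_near. Qed.

Lemma bump_alg_diff f : bump_alg f -> forall x, differentiable f x.
Proof.
elim=> {f} [c x|p i c d x|f g _ hf _ hg x|f g _ hf _ hg x].
- exact: differentiable_cst.
- apply: differentiable_comp; first exact: affine_coord_diff.
  exact: flat_differentiable.
- exact: differentiableD.
- exact: differentiableM.
Qed.

Lemma bump_alg_derive f v : bump_alg f -> bump_alg ('D_v f).
Proof.
elim=> {f} [c|p i c d|f g bf hf bg hg|f g bf hf bg hg].
- rewrite (_ : 'D_v _ = cst 0); first exact: bump_cst.
  by apply/funext => x; rewrite derive_cst.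
- rewrite (_ : 'D_v _ = (cst (c * v ord0 i)) \*
      (fun x => flat ('X^2 * (p - p^`())) (c * x ord0 i + d))).
    by apply: bumpM; [exact: bump_cst|exact: bump_flat].
  apply/funext => x.
  have du := affine_coord_diff i c d x.
  have dF := flat_differentiable p (c * x ord0 i + d).
  rewrite deriveE; last exact: differentiable_comp.
  rewrite (_ : (fun x => _) = flat p \o (fun x : 'rV[R]_n => c * x ord0 i + d))//.
  rewrite diff_comp//= -[X in 'd _ _ X]deriveE// derive_affine_coord.
  by rewrite diff1E// derive1E (@derive_val _ _ _ _ _ _ _ (is_derive_flat p _)).
- rewrite (_ : 'D_v _ = 'D_v f \+ 'D_v g); first exact: bumpD.
  by apply/funext => x; rewrite deriveD//; apply: diff_derivable; exact: bump_alg_diff.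
- rewrite (_ : 'D_v _ = (f \* 'D_v g) \+ (g \* 'D_v f)).
    by apply: bumpD; exact: bumpM.
  by apply/funext => x; rewrite deriveM//; apply: diff_derivable; exact: bump_alg_diff.
Qed.

Lemma bump_alg_smooth f : bump_alg f -> smooth (fun x => (f x)%:C).
Proof.
move=> bf s x; have H h : bump_alg h -> bump_alg (partials h s).
  by move=> bh; elim: s => [//|i s IHs] /=; exact: bump_alg_derive.
by split; apply: bump_alg_diff; apply: H => //; exact: (bump_cst 0).
Qed.

Lemma bump_alg_prod (I : Type) (r : seq I) (F : I -> 'rV[R]_n -> R) :
  (forall i, bump_alg (F i)) -> bump_alg (fun x => \prod_(i <- r) F i x).
Proof.
move=> bF; elim: r => [|a r IHr].
  by under eq_fun do rewrite big_nil; exact: bump_cst.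
by under eq_fun do rewrite big_cons; exact: bumpM.
Qed.

End bump_algebra.

Section cube_bumps.
Context {R : realType}.
Notation leb := (@lebesgue_measure R).
Implicit Types (a r y : R).

(** The arguments are [(y - a) / r] and [(a + r - y) / r], written in the affine form that
    [bump_flat] expects. *)
Definition interval_bump a r y : R :=
  flat 1 (r^-1 * y + - (a / r)) * flat 1 (- r^-1 * y + (a + r) / r).

Lemma flat1E y : flat 1 y = if 0 < y then expR (- y^-1) else 0 :> R.
Proof. by rewrite /flat hornerC mul1r. Qed.

Lemma flat1_ge0 y : 0 <= flat 1 y.
Proof. by rewrite flat1E; case: ifP => // _; exact: expR_ge0. Qed.

Lemma flat1_le1 y : flat 1 y <= 1.
Proof. by rewrite flat1E; case: ifP => // y0; rewrite expR_le1 oppr_le0 invr_ge0 ltW. Qed.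

Lemma interval_bump_ge0 a r y : 0 <= interval_bump a r y.
Proof. by rewrite mulr_ge0 ?flat1_ge0. Qed.

Lemma interval_bump_le1 a r y : interval_bump a r y <= 1.
Proof. by rewrite mulr_ile1 ?flat1_ge0 ?flat1_le1. Qed.

Lemma interval_bump_neq0 a r y : 0 < r -> interval_bump a r y != 0 -> a < y < a + r.
Proof.
move=> r0; rewrite mulf_eq0 negb_or !flat1E => /andP[].
have -> : r^-1 * y - a / r = (y - a) / r by field; rewrite gt_eqF.
have -> : - r^-1 * y + (a + r) / r = (a + r - y) / r by field; rewrite gt_eqF.
rewrite !pmulr_lgt0 ?invr_gt0// !subr_gt0.
by case: (a < y); rewrite ?eqxx//; case: (y < a + r); rewrite ?eqxx.
Qed.

Lemma continuous_interval_bump a r : continuous (interval_bump a r).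
Proof.
have cf (c d : R) : continuous (fun y => flat 1 (c * y + d)).
  move=> y; apply: (@continuous_comp _ _ _ (fun y => c * y + d) (flat 1)).
    by apply: cvgD; [apply: cvgM; [exact: cvg_cst|exact: cvg_id]|exact: cvg_cst].
  exact/differentiable_continuous/flat_differentiable.
by move=> y; apply: cvgM; exact: cf.
Qed.

Lemma interval_bump_out a r y : 0 < r -> y \notin `[a, a + r] -> interval_bump a r y = 0.
Proof.
move=> r0; rewrite in_itv/= => h; apply/eqP; apply: contraNT h.
by move=> /(interval_bump_neq0 r0)/andP[/ltW-> /ltW->].
Qed.

Lemma integrable_interval_bump a r : 0 < r ->
  leb.-integrable setT (EFin \o interval_bump a r).
Proof.
move=> r0.
have mb : measurable_fun setT (EFin \o interval_bump a r).
  by apply/measurable_EFinP; apply: continuous_measurable_fun; exact: continuous_interval_bump.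
have i1 : leb.-integrable setT (EFin \o \1_[set` `[a, a + r]]).
  exact: (@integrable_indic_itv R a (a + r) true false).
apply: (le_integrable measurableT) i1 => // y _ /=.
rewrite lee_fin ger0_norm ?interval_bump_ge0// ger0_norm// indicE.
have [yI|yI] := boolP (y \in `[a, a + r]).
  by rewrite mem_set//= interval_bump_le1.
by rewrite interval_bump_out.
Qed.

(* On the middle half of the interval both factors are at least [exp (- 4)]. *)
Lemma integral_interval_bump_ge a r : 0 < r ->
  expR (- 8) / 2 * r <= \int[leb]_y interval_bump a r y.
Proof.
move=> r0; have ib := integrable_interval_bump a r0.
have mb : measurable_fun setT (EFin \o interval_bump a r) by exact: measurable_int ib.
rewrite -lee_fin /Rintegral fineK; last exact: integrable_fin_num.
have -> : ((expR (- 8) / 2 * r)%:E =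
    \int[leb]_(x in `[(a + r / 4)%R, (a + r / 4 + r / 2)%R]) (cst (expR (- 8))%:E x))%E.
  rewrite integral_cst//= lebesgue_measure_itv/= lte_fin ltrDl divr_gt0//.
  by rewrite -EFinB -EFinM; congr _%:E; field.
apply: (@le_trans _ _ (\int[leb]_(x in `[(a + r / 4)%R, (a + r / 4 +
  r / 2)%R]) (interval_bump a r x)%:E)%E).
  apply: ge0_le_integral => //=.
  - exact: (measurable_funTS mb).
  - move=> x; rewrite in_itv/= => /andP[x0 x1]; rewrite lee_fin.
    have H (z : R) : 4^-1 <= z -> expR (- 4) <= flat 1 z.
      move=> hz; have z0 : 0 < z by apply: lt_le_trans hz; rewrite invr_gt0.
      by rewrite flat1E z0 ler_expR lerN2 -[leRHS]invrK lef_pV2 ?posrE ?invr_gt0.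
    rewrite (_ : - 8 = - 4 - 4 :> R); last by ring.
    rewrite expRD ler_pM ?expR_ge0//; apply: H.
      rewrite (_ : _ - _ = (x - a) / r); last by field; rewrite gt_eqF.
      by rewrite ler_pdivlMr//; lra.
    rewrite (_ : _ + _ / _ = (a + r - x) / r); last by field; rewrite gt_eqF.
    by rewrite ler_pdivlMr//; lra.
apply: ge0_subset_integral => //= x _.
by rewrite lee_fin interval_bump_ge0.
Qed.

Section several_variables.
Context {n : nat}.
Implicit Types (c : 'I_n -> R) (x : 'rV[R]_n).

Definition cube_bump c r x : R := \prod_(i < n) interval_bump (c i) r (x ord0 i).

Lemma cube_bump_ge0 c r x : 0 <= cube_bump c r x.
Proof. by apply: prodr_ge0 => i _; exact: interval_bump_ge0. Qed.

Lemma cube_bump_neq0 c r x : 0 < r -> cube_bump c r x != 0 ->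
  forall i, c i < x ord0 i < c i + r.
Proof.
by move=> r0 /prodf_neq0 h i; apply: interval_bump_neq0 => //; exact: h.
Qed.

Lemma integrable_cube_bump c r : 0 < r ->
  (lebesgue_rV n).-integrable setT (fun x => (cube_bump c r x)%:E).
Proof.
by move=> r0; have [|+ _] := @Rint_rV_prod R n (fun i => interval_bump (c i) r) => [i|//];
  exact: integrable_interval_bump.
Qed.

Lemma integral_cube_bump_ge c r : 0 < r ->
  (expR (- 8) / 2 * r) ^+ n <= \int[lebesgue_rV n]_x cube_bump c r x.
Proof.
move=> r0; have [|_ ->] := @Rint_rV_prod R n (fun i => interval_bump (c i) r).
  by move=> i; exact: integrable_interval_bump.
rewrite -[X in _ ^+ X](card_ord n) -prodr_const; apply: ler_prod => i _.
by rewrite integral_interval_bump_ge// !mulr_ge0// ?expR_ge0// ltW.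
Qed.

Lemma test_function_cube_bump c r (D : set 'rV[R]_n) : 0 < r ->
  (forall x, (forall i, c i <= x ord0 i <= c i + r) -> D x) ->
  test_function D (fun x => (cube_bump c r x)%:C).
Proof.
move=> r0 cD.
pose K : set 'rV[R]_n := [set x | forall i, [set` `[c i, c i + r]] (x ord0 i)].
have cK : compact K by apply: (rV_compact (A := fun i => [set` `[c i, c i + r]])) => i;
  exact: segment_compact.
have clK : closed K by apply: compact_closed => //; exact: norm_hausdorff.
have sK : closure [set x | (cube_bump c r x)%:C != 0] `<=` K.
  rewrite [X in _ `<=` X](closure_id K).1//; apply: closure_subset => x /= h i.
  rewrite /= in_itv/=; suff /(cube_bump_neq0 r0)/(_ i)/andP[/ltW-> /ltW->] : cube_bump c r x !=
    0 by [].
  by apply: contra h => /eqP ->.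
split.
- apply: bump_alg_smooth; apply: bump_alg_prod => i.
  by apply: bumpM; exact: bump_flat.
- exact: subclosed_compact (@closed_closure _ _) cK sK.
- by move=> x /sK h; apply: cD => i; have := h i; rewrite /= in_itv.
Qed.

End several_variables.
End cube_bumps.

(** * The phase near the train of frequencies *)

Section polynomial_bounds.
Context {R : realType}.
Implicit Types (z X : R).

(* With [d k = (1 + z) ^ k - (1 - z) ^ k] and [s k = (1 + z) ^ k + (1 - z) ^ k - 2],
   one has [d k.+1 = d k + z (s k + 2)] and [s k.+1 = s k + z d k]. *)
Lemma odd_binomial_cubic k z : 0 <= z <= 1 ->
  `|(1 + z) ^+ k - (1 - z) ^+ k - 2 * k%:R * z| <= 4 ^+ k * z ^+ 3.
Proof.
move=> /andP[z0 z1].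
have z2 : z ^+ 2 <= z by rewrite expr2 ler_piMr.
have z3 : z ^+ 3 <= z ^+ 2 by rewrite exprS ler_piMl ?sqr_ge0.
suff [] : [/\ `|(1 + z) ^+ k - (1 - z) ^+ k| <= 4 ^+ k * z,
  `|(1 + z) ^+ k + (1 - z) ^+ k - 2| <= 4 ^+ k * z ^+ 2 &
  `|(1 + z) ^+ k - (1 - z) ^+ k - 2 * k%:R * z| <= 4 ^+ k * z ^+ 3] by [].
elim: k => [|k [hd hs he]].
  rewrite !expr0 subrr mulr0 mul0r subr0 normr0.
  rewrite (_ : 1 + 1 - 2 = 0 :> R); last by ring.
  by rewrite normr0; split; rewrite mul1r ?exprn_ge0.
have k1 : 1 <= 4 ^+ k :> R by rewrite exprn_ege1// ler1n.
set a := (1 + z) ^+ k in hd hs he *; set b := (1 - z) ^+ k in hd hs he *.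
set c := 4 ^+ k in hd hs he k1 *.
have zd : `|z * (a - b)| <= c * z ^+ 2.
  by rewrite normrM (ger0_norm z0) expr2 mulrCA ler_wpM2l.
have zs : `|z * (a + b - 2)| <= c * z ^+ 3.
  by rewrite normrM (ger0_norm z0) exprS mulrCA ler_wpM2l.
have cz3 : c * z ^+ 3 <= c * z by rewrite ler_wpM2l ?(le_trans ler01 k1)// (le_trans z3).
have cz : z <= c * z by rewrite ler_peMl.
rewrite !exprSr -/a -/b -/c -natr1; split.
- rewrite (_ : _ - _ = (a - b) + z * (a + b - 2) + 2 * z); last by ring.
  apply: le_trans (ler_normD _ _) _; apply: le_trans (lerD (ler_normD _ _) (lexx _)) _.
  rewrite (@ger0_norm _ (2 * z)) ?mulr_ge0//; lra.
- rewrite (_ : _ - 2 = (a + b - 2) + z * (a - b)); last by ring.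
  apply: le_trans (ler_normD _ _) _.
  have := sqr_ge0 z; have c0 : 0 <= c by rewrite (le_trans _ k1).
  move=> q0; have := mulr_ge0 c0 q0; lra.
- rewrite (_ : _ - _ - _ = (a - b - 2 * k%:R * z) + z * (a + b - 2)); last by ring.
  apply: le_trans (ler_normD _ _) _.
  have c0 : 0 <= c by rewrite (le_trans _ k1).
  have q0 : 0 <= z ^+ 3 by rewrite exprn_ge0.
  have := mulr_ge0 c0 q0; lra.
Qed.

Lemma norm_subX_le k (u w : R) X : `|u| <= X -> `|w| <= X ->
  `|u ^+ k.+1 - w ^+ k.+1| <= k.+1%:R * `|u - w| * X ^+ k.
Proof.
move=> uX wX; have X0 : 0 <= X by exact: le_trans uX.
elim: k => [|k IHk]; first by rewrite !expr1 expr0 mul1r mulr1.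
rewrite exprSr [w ^+ k.+2]exprSr.
rewrite (_ : _ - _ = u ^+ k.+1 * (u - w) + w * (u ^+ k.+1 - w ^+ k.+1)); last by ring.
apply: le_trans (ler_normD _ _) _; rewrite !normrM normrX.
have h1 : `|u| ^+ k.+1 * `|u - w| <= X ^+ k.+1 * `|u - w|.
  by rewrite ler_wpM2r// lerXn2r ?nnegrE.
have h2 : `|w| * `|u ^+ k.+1 - w ^+ k.+1| <= X * (k.+1%:R * `|u - w| * X ^+ k).
  exact: ler_pM.
rewrite (le_trans (lerD h1 h2))// -[k.+2%:R]natr1 !exprS; lra.
Qed.

Context {n : nat}.
Implicit Types (v : 'I_n -> R) (P : mpoly n R).

Lemma norm_monomial_le v (B : R) (m : multinom n) :
  (forall i, m i != 0%N -> `|v i| <= B) ->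
  `|\prod_i v i ^+ m i| <= B ^+ mdeg m.
Proof.
move=> vB; rewrite normr_prod mdegE expr_sum; apply: ler_prod => i _.
rewrite normr_ge0 normrX; have [->|mi] := eqVneq (m i) 0%N; first by rewrite !expr0 lexx.
by rewrite lerXn2r ?nnegrE// ?vB// (le_trans _ (vB i mi)).
Qed.

(** The predicate isolates the lower-order terms of [P]. The bound [B] is asked only of variables
    occurring in the monomial, so for [Q], free of the two large coordinates, [B] may be taken much
    smaller than [N]. *)
Lemma norm_meval_sub_le P (C : pred (multinom n)) (e : nat) v (B : R) : 1 <= B ->
  (forall m, m \in msupp P -> C m -> (mdeg m <= e)%N /\ forall i, m i != 0%N -> `|v i| <= B) ->
  `|\sum_(m <- msupp P | C m) mcoeff m P * \prod_i v i ^+ m i| <=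
  (\sum_(m <- msupp P) `|mcoeff m P|) * B ^+ e.
Proof.
move=> B1 H; rewrite mulr_suml [leRHS](bigID C) /= (le_trans (ler_norm_sum _ _ _))//.
rewrite ler_wpDr//.
  by apply: sumr_ge0 => m _; rewrite mulr_ge0// exprn_ge0// (le_trans ler01).
rewrite big_seq_cond [leRHS]big_seq_cond; apply: ler_sum => m /andP[mP Cm].
have [me vB] := H m mP Cm; rewrite normrM ler_wpM2l//.
by rewrite (le_trans (norm_monomial_le vB))// ler_weXn2l.
Qed.

(** Here [v] lies within [D] of the centre number [j] of the train and [v0] is the centre for
    [j = 0]. Up to the stated error [P] is affine in [j] along the train: the quadratic term is
    absent by parity, and [j ^ 3 <= N ^ 2] brings the cubic one down to [N ^ (k - 1)]. For times of
    size [N ^ (1 - k)] the error is of order [D]. *)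
Lemma phase_estimate (k : nat) (i0 i1 : 'I_n) P Q (c1 c2 rho : R) :
  (0 < k)%N -> odd k -> nat_of_ord i0 = 0%N -> nat_of_ord i1 = 1%N ->
  mmeasure mdeg P = k.+1 -> 0 < c1 -> 0 < rho -> c2 = c1 * rho ^+ k ->
  Q \is ishomog1 k mdeg -> free_of_first 2 Q ->
  pihomog mdeg k P = c1 *: mpolyX R (mnm1 i0) ^+ k + c2 *: mpolyX R (mnm1 i1) ^+ k + Q ->
  exists2 K, 0 < K & forall N j D v v0,
    1 <= D -> D <= N -> 0 <= j -> j <= N -> j ^+ 3 <= N ^+ 2 ->
    `|v i0 - (N + j)| <= D -> `|v i1 - (j - N) / rho| <= D ->
    (forall i, i != i0 -> i != i1 -> `|v i| <= D) ->
    v0 i0 = N -> v0 i1 = - N / rho -> (forall i, i != i0 -> i != i1 -> v0 i = 0) ->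
    `|meval v P - meval v0 P - 2 * k%:R * c1 * N ^+ k.-1 * j| <= K * N ^+ k.-1 * D.
Proof.
case: k => // k _ kodd i00 i11 Pk c10 rho0 c2E /dhomogP Qk Qfree Plead.
pose CQ : R := \sum_(m <- msupp Q) `|mcoeff m Q|.
pose CP : R := \sum_(m <- msupp P) `|mcoeff m P|.
have CQ0 : 0 <= CQ by exact: sumr_ge0.
have CP0 : 0 <= CP by exact: sumr_ge0.
pose b := 3 + 3 / rho.
have r0 : 0 < rho^-1 by rewrite invr_gt0.
have b1 : 1 <= b by rewrite /b; lra.
(* In units of [N], these bound [v i0] and [rho * v i1], while [b] bounds all coordinates of [v] and
   [v0]. *)
pose X1 : R := 3; pose X2 := 2 + rho.
(* The terms pay for moving [v i0] and [v i1] onto the line, for the cubic remainder, and for [Q]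
   and the lower-order part at both [v] and [v0]; the final 1 ensures positivity. *)
exists (c1 * (k.+1%:R * X1 ^+ k) + c1 * (k.+1%:R * rho * X2 ^+ k) + c1 * 4 ^+ k.+1 + 2 * CQ +
  2 * CP * b ^+ k + 1).
  rewrite ltr_wpDl// !addr_ge0// !mulr_ge0// ?exprn_ge0 ?(ltW c10) ?(ltW rho0)//; rewrite /X2; lra.
move=> N j D v v0 D1 DN j0 jN j3 h0 h1 h2 v00 v01 v02.
have N1 : 1 <= N by exact: le_trans DN.
have N0 : 0 < N by exact: lt_le_trans N1.
have i01 : i0 != i1 by apply/eqP => e; move: i11; rewrite -e i00.
have evalE (w : 'I_n -> R) : meval w P = c1 * w i0 ^+ k.+1 + c2 * w i1 ^+ k.+1 + meval w Q +
    \sum_(m <- msupp P | mdeg m != k.+1) mcoeff m P * \prod_i w i ^+ m i.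
  rewrite mevalE (bigID (fun m => mdeg m == k.+1)) /=; congr (_ + _).
  transitivity (meval w (pihomog mdeg k.+1 P)).
    rewrite pihomogE raddf_sum /=; apply: eq_bigr => m _.
    by rewrite mevalZ mevalX.
  by rewrite Plead !mevalD !mevalZ !rmorphXn /= !mevalXU.
pose L (w : 'I_n -> R) := \sum_(m <- msupp P | mdeg m != k.+1) mcoeff m P * \prod_i w i ^+ m i.
have Lb w : (forall i, `|w i| <= b * N) -> `|L w| <= CP * (b * N) ^+ k.
  move=> wb; apply: norm_meval_sub_le => [|m mP mk].
    by rewrite -[1]mulr1 ler_pM.
  split=> [|i _]; last exact: wb.
  have := mmeasure_mnm_lt mdeg mP; rewrite Pk ltnS leq_eqVlt (negbTE mk) /=.
  by rewrite ltnS.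
have Qb w : (forall i, i != i0 -> i != i1 -> `|w i| <= D) -> `|meval w Q| <= CQ * D ^+ k.+1.
  move=> wb; rewrite mevalE; apply: norm_meval_sub_le => // m mQ _.
  rewrite Qk//; split => // i mi; apply: wb; apply: contraNneq mi => ie.
    by rewrite (Qfree m mQ) ?ie ?i00.
  by rewrite (Qfree m mQ) ?ie ?i11.
have vb i : `|v i| <= b * N.
  have bN : b * N = 3 * N + 3 * (N * rho^-1) by rewrite /b; ring.
  have q0 : 0 <= N * rho^-1 by rewrite mulr_ge0// ltW.
  have jr : j * rho^-1 <= N * rho^-1 by rewrite ler_wpM2r// ltW.
  have jr0 : 0 <= j * rho^-1 by rewrite mulr_ge0// ltW.
  rewrite bN; have [->|ii0] := eqVneq i i0.
    by move: h0; rewrite !ler_norml => /andP[g1 g2]; apply/andP; split; lra.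
  have [->|ii1] := eqVneq i i1.
    by move: h1; rewrite mulrBl !ler_norml => /andP[g1 g2]; apply/andP; split; lra.
  by rewrite (le_trans (h2 _ _ _))//; lra.
have v0b i : `|v0 i| <= b * N.
  have bN : b * N = 3 * N + 3 * (N * rho^-1) by rewrite /b; ring.
  have q0 : 0 <= N * rho^-1 by rewrite mulr_ge0// ltW.
  rewrite bN; have [->|ii0] := eqVneq i i0; first by rewrite v00 ger0_norm; lra.
  have [->|ii1] := eqVneq i i1; first by rewrite v01 mulNr normrN ger0_norm//; lra.
  by rewrite v02// normr0; lra.
have T1 : `|v i0 ^+ k.+1 - (N + j) ^+ k.+1| <= k.+1%:R * D * (X1 * N) ^+ k.
  apply: le_trans (norm_subX_le k (_ : _ <= X1 * N) (_ : _ <= X1 * N)) _.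
  - by move: h0; rewrite /X1 !ler_norml => /andP[g1 g2]; apply/andP; split; lra.
  - by rewrite /X1 ger0_norm; lra.
  - by rewrite ler_wpM2r ?exprn_ge0 ?mulr_ge0 ?(ltW N0)// ler_wpM2l.
have T2 : `|(rho * v i1) ^+ k.+1 - (j - N) ^+ k.+1| <= k.+1%:R * (rho * D) * (X2 * N) ^+ k.
  have e : `|rho * v i1 - (j - N)| <= rho * D.
    have -> : rho * v i1 - (j - N) = rho * (v i1 - (j - N) / rho) by field; rewrite gt_eqF.
    by rewrite normrM (gtr0_norm rho0) ler_wpM2l// ltW.
  have rD : rho * D <= rho * N by rewrite ler_wpM2l// ltW.
  apply: le_trans (norm_subX_le k (_ : _ <= X2 * N) (_ : _ <= X2 * N)) _.
  - by move: e; rewrite /X2 mulrDl !ler_norml => /andP[g1 g2]; apply/andP; split; lra.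
  - rewrite /X2 mulrDl ler_norml; have := mulr_gt0 rho0 N0 => q; apply/andP; split; lra.
  - by rewrite ler_wpM2r ?exprn_ge0 ?mulr_ge0 ?(ltW N0) ?ler_wpM2l// /X2; lra.
(* By oddness the second power is [- (N - j) ^ k.+1]; this is [odd_binomial_cubic] at [z = j / N],
   scaled by [N ^ k.+1]. *)
have T3 : `|(N + j) ^+ k.+1 + (j - N) ^+ k.+1 - 2 * k.+1%:R * N ^+ k * j| <= 4 ^+ k.+1 * N ^+ k.
  have z01 : 0 <= j / N <= 1 by rewrite divr_ge0 ?(ltW N0)//= ler_pdivrMr// mul1r.
  have Nk : N ^+ k != 0 by rewrite expf_neq0// gt_eqF.
  have := odd_binomial_cubic k.+1 z01.
  have e1 : N ^+ k.+1 * (1 + j / N) ^+ k.+1 = (N + j) ^+ k.+1.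
    by rewrite -exprMn mulrDr mulr1 mulrCA divff ?gt_eqF// mulr1.
  have e2 : N ^+ k.+1 * (1 - j / N) ^+ k.+1 = - (j - N) ^+ k.+1.
    rewrite -exprMn mulrBr mulr1 mulrCA divff ?gt_eqF// mulr1.
    by rewrite -opprB exprNn -signr_odd kodd expr1 mulN1r.
  have e3 : N ^+ k.+1 * (2 * k.+1%:R * (j / N)) = 2 * k.+1%:R * N ^+ k * j.
    by rewrite exprS; field; rewrite gt_eqF.
  rewrite -(@ler_pM2l _ (N ^+ k.+1)) ?exprn_gt0// -{1}(ger0_norm (exprn_ge0 k.+1 (ltW N0))) -normrM.
  rewrite !mulrBr e1 e2 e3 opprK => /le_trans; apply.
  rewrite mulrCA ler_wpM2l ?exprn_ge0//.
  rewrite [leLHS](_ : _ = N ^+ k * (j ^+ 3 / N ^+ 2)).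
    by rewrite ler_piMr ?exprn_ge0 ?(ltW N0)// ler_pdivrMr ?exprn_gt0// mul1r.
  by rewrite exprS; field; rewrite gt_eqF.
have rk : c2 * v i1 ^+ k.+1 = c1 * (rho * v i1) ^+ k.+1 by rewrite c2E exprMn mulrA.
have rk0 : c2 * v0 i1 ^+ k.+1 = - (c1 * N ^+ k.+1).
  rewrite c2E -mulrA -exprMn v01 mulrCA divff ?gt_eqF// mulr1.
  by rewrite exprNn -signr_odd kodd expr1 mulN1r mulrN.
(* The form [Q] sees only coordinates of size [D <= N], so it fits within the error. *)
have DN' : D ^+ k.+1 <= N ^+ k * D.
  by rewrite exprSr ler_wpM2r ?(le_trans ler01)// lerXn2r ?nnegrE ?(ltW N0) ?(le_trans ler01).
have Q1 : `|meval v Q| <= CQ * (N ^+ k * D).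
  by rewrite (le_trans (Qb v h2))// ler_wpM2l.
have Q0 : `|meval v0 Q| <= CQ * (N ^+ k * D).
  apply: le_trans (Qb v0 _) _; last by rewrite ler_wpM2l.
  by move=> i ii0 ii1; rewrite v02// normr0 (le_trans ler01).
have M0 : 0 <= N ^+ k by rewrite exprn_ge0// ltW.
have MD : N ^+ k <= N ^+ k * D by rewrite ler_peMr.
have L1 : `|L v| <= CP * b ^+ k * (N ^+ k * D).
  rewrite (le_trans (Lb v vb))// exprMn mulrA ler_wpM2l//.
  by rewrite mulr_ge0// exprn_ge0// (le_trans ler01).
have L0 : `|L v0| <= CP * b ^+ k * (N ^+ k * D).
  rewrite (le_trans (Lb v0 v0b))// exprMn mulrA ler_wpM2l//.
  by rewrite mulr_ge0// exprn_ge0// (le_trans ler01).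
rewrite /= !evalE -/(L v) -/(L v0) rk rk0 v00.
rewrite [X in `|X|](_ : _ = c1 * (v i0 ^+ k.+1 - (N + j) ^+ k.+1) +
   c1 * ((rho * v i1) ^+ k.+1 - (j - N) ^+ k.+1) +
   c1 * ((N + j) ^+ k.+1 + (j - N) ^+ k.+1 - 2 * k.+1%:R * N ^+ k * j) +
   meval v Q - meval v0 Q + L v - L v0); last by ring.
have S1 : `|c1 * (v i0 ^+ k.+1 - (N + j) ^+ k.+1)| <= c1 * (k.+1%:R * X1 ^+ k) * (N ^+ k * D).
  rewrite normrM (gtr0_norm c10) -mulrA ler_wpM2l ?(ltW c10)// (le_trans T1)// exprMn.
  by rewrite le_eqVlt; apply/orP; left; apply/eqP; ring.
have S2 : `|c1 * ((rho * v i1) ^+ k.+1 - (j - N) ^+ k.+1)| <= c1 * (k.+1%:R * rho * X2 ^+ k) *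
  (N ^+ k * D).
  rewrite normrM (gtr0_norm c10) -mulrA ler_wpM2l ?(ltW c10)// (le_trans T2)// exprMn.
  by rewrite le_eqVlt; apply/orP; left; apply/eqP; ring.
have S3 : `|c1 * ((N + j) ^+ k.+1 +
  (j - N) ^+ k.+1 - 2 * k.+1%:R * N ^+ k * j)| <= c1 * 4 ^+ k.+1 * (N ^+ k * D).
  rewrite normrM (gtr0_norm c10) -[leRHS]mulrA ler_wpM2l ?(ltW c10)// (le_trans T3)// ler_wpM2l//.
have ND0 : 0 <= N ^+ k * D by rewrite mulr_ge0// (le_trans ler01).
rewrite [leRHS](_ : _ = c1 * (k.+1%:R * X1 ^+ k) * (N ^+ k * D) +
  c1 * (k.+1%:R * rho * X2 ^+ k) * (N ^+ k * D) + c1 * 4 ^+ k.+1 * (N ^+ k * D) +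
  2 * (CQ * (N ^+ k * D)) + 2 * (CP * b ^+ k * (N ^+ k * D)) + N ^+ k * D); last by ring.
move: S1 S2 S3 Q1 Q0 L1 L0.
move: (c1 * (v i0 ^+ _ - _)) (c1 * (_ - (j - N) ^+ _)) (c1 * (_ - 2 * _ * _ * _)) => s1 s2 s3.
move: (meval v Q) (meval v0 Q) (L v) (L v0) => q1 q0 l1 l0.
move: (_ * (k.+1%:R * X1 ^+ k) * _) (_ * (k.+1%:R * rho * X2 ^+ k) * _) => a1 a2.
move: (_ * 4 ^+ _ * _) (CQ * _) (CP * _ * _) => a3 a4 a5.
move: (N ^+ k * D) ND0 => d d0.
rewrite !ler_norml.
move=> /andP[? ?] /andP[? ?] /andP[? ?] /andP[? ?] /andP[? ?] /andP[? ?] /andP[? ?].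
by apply/andP; split; lra.
Qed.

End polynomial_bounds.

(** * Wave packets *)

Section wave_packets.
Context {R : realType} {n : nat}.
Notation leb := (@lebesgue_measure R).
Notation lebn := (@lebesgue_rV R n).
Implicit Types (x y xi c : 'rV[R]_n) (f phi psi : 'rV[R]_n -> R[i]).

Lemma measurable_dotp d (T : measurableType d) (f g : T -> 'rV[R]_n) :
  (forall i, measurable_fun setT (fun t => f t ord0 i)) ->
  (forall i, measurable_fun setT (fun t => g t ord0 i)) ->
  measurable_fun setT (fun t => dotp (f t) (g t)).
Proof.
by move=> mf mg; apply: measurable_sum => i; exact: measurable_funM.
Qed.

Lemma measurable_dotpl xi : measurable_fun setT (fun x => dotp x xi).
Proof.
by apply: measurable_dotp => i; [exact: measurable_rV_coord|exact: measurable_cst].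
Qed.

Lemma measurable_fst_coord d (T : measurableType d) i :
  measurable_fun setT (fun z : 'rV[R]_n * T => z.1 ord0 i).
Proof. exact: (measurableT_comp (measurable_rV_coord i) measurable_fst). Qed.

Lemma measurable_snd_coord d (T : measurableType d) i :
  measurable_fun setT (fun z : T * 'rV[R]_n => z.2 ord0 i).
Proof. exact: (measurableT_comp (measurable_rV_coord i) measurable_snd). Qed.

Lemma dotpC x xi : dotp x xi = dotp xi x.
Proof. by apply: eq_bigr => i _; rewrite mulrC. Qed.

Lemma dotpBr x y xi : dotp x (y - xi) = dotp x y - dotp x xi.
Proof. by rewrite -sumrB; apply: eq_bigr => i _; rewrite !mxE mulrBr. Qed.

Lemma prod1Dsqr_ge x : 1 + sqnorm x <= \prod_(i < n) (1 + x ord0 i ^+ 2).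
Proof.
suff [] : 0 <= sqnorm x /\ 1 + sqnorm x <= \prod_(i < n) (1 + x ord0 i ^+ 2) by [].
rewrite /sqnorm /dotp.
apply: (big_rec2 (fun s p => 0 <= s /\ 1 + s <= p)) => [|i p s _ [s0 h]].
  by rewrite addr0.
have q0 : 0 <= x ord0 i * x ord0 i by rewrite -expr2 sqr_ge0.
by rewrite expr2; split; [exact: addr_ge0|nra].
Qed.

Lemma sqnorm_ge0 x : 0 <= sqnorm x.
Proof. by apply: sumr_ge0 => i _; rewrite -expr2 sqr_ge0. Qed.

Lemma prod1Dsqr_le x : \prod_(i < n) (1 + x ord0 i ^+ 2) <= (1 + sqnorm x) ^+ n.
Proof.
rewrite -[X in _ ^+ X](card_ord n) -prodr_const; apply: ler_prod => i _.
rewrite addr_ge0 ?sqr_ge0//= lerD2l /sqnorm /dotp (bigD1 i)//= -expr2 lerDl.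
by apply: sumr_ge0 => j _; rewrite -expr2 sqr_ge0.
Qed.

Section schwartz_functions.
Variable phi : 'rV[R]_n -> R[i].
Hypothesis sphi : schwartz phi.

Lemma schwartz_Cmeas : Cmeas setT phi.
Proof.
have [sm _] := sphi.
by split; apply: continuous_measurable_rV => x; apply: differentiable_continuous;
  have [] := sm [::] x.
Qed.

Lemma schwartz_bound0 N M x : schwartz_bound phi N M ->
  (1 + sqnorm x) ^+ N * normc (phi x) <= M.
Proof.
by move=> /(_ [::] isT x); rewrite /Cpartials /=; case: (phi x).
Qed.

Lemma schwartz_integrable : Cintg lebn setT phi.
Proof.
(* Decay of order [n] in [1 + |x| ^ 2] is enough to dominate [prod_i (1 + x_i ^ 2)]. *)
have [_ /(_ n)[M HM]] := sphi.
have [|im _] := @Rint_rV_prod R n (fun=> inv1sqr).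
  by move=> i; exact: integrable_inv1sqr.
have im' : lebn.-integrable setT (EFin \o (fun x => M * \prod_(i < n) inv1sqr (x ord0 i))).
  rewrite (_ : _ \o _ = (fun x => M%:E * (\prod_(i < n) inv1sqr (x ord0 i))%:E)%E)//.
  exact: integrableZl.
apply: (Cintg_dom measurableT schwartz_Cmeas im') => x _.
have h := schwartz_bound0 x HM.
have p0 : 0 < \prod_(i < n) (1 + x ord0 i ^+ 2).
  by apply: prodr_gt0 => i _; rewrite ltr_pwDl// sqr_ge0.
rewrite prodfV ler_pdivlMr// mulrC; apply: le_trans h.
by rewrite ler_wpM2r ?normc_ge0// prod1Dsqr_le.
Qed.

End schwartz_functions.

Definition envelope x : R := \prod_(i < n) exp_tent (x ord0 i).

(** This is the Fourier transform of [envelope] modulated to the frequency [c]. *)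
Definition packet c xi : R := \prod_(i < n) inv1sqr (xi ord0 i - c ord0 i) ^+ 2.

Lemma envelope_ge0 x : 0 <= envelope x.
Proof. by apply: prodr_ge0 => i _; exact: exp_tent_ge0. Qed.

Lemma packet_ge0 c xi : 0 <= packet c xi.
Proof. by apply: prodr_ge0 => i _; rewrite sqr_ge0. Qed.

Lemma integrable_envelope : lebn.-integrable setT (EFin \o envelope).
Proof.
by have [|] := @Rint_rV_prod R n (fun=> exp_tent) => [i|//]; exact: integrable_exp_tent.
Qed.

Lemma measurable_envelope : measurable_fun setT envelope.
Proof. by apply/measurable_EFinP; exact: measurable_int integrable_envelope. Qed.

Lemma packet_integral c : lebn.-integrable setT (EFin \o packet c) /\
  \int[lebn]_xi packet c xi = (\int[leb]_t (inv1sqr t ^+ 2)) ^+ n.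
Proof.
have sh (a : R) := integrable_shift a (@continuous_sqr_inv1sqr R)
  (fun=> sqr_ge0 _) integrable_sqr_inv1sqr.
have [|i e] := @Rint_rV_prod R n (fun i (t : R) => inv1sqr (t - c ord0 i) ^+ 2).
  by move=> i; have [] := sh (c ord0 i).
split => //; rewrite e -[X in _ ^+ X](card_ord n) -prodr_const.
by apply: eq_bigr => j _; have [] := sh (c ord0 j).
Qed.

(** The weight costs one of the two powers of [inv1sqr]. What remains has an integral independent of
    [c], which makes phase errors and Sobolev weights summable over the train. *)
Lemma weighted_packetE c xi :
  (\prod_(i < n) (1 + (xi ord0 i - c ord0 i) ^+ 2)) * packet c xi =
  \prod_(i < n) inv1sqr (xi ord0 i - c ord0 i).
Proof.
rewrite -big_split; apply: eq_bigr => i _ /=.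
by rewrite [inv1sqr _ ^+ 2]expr2 mulrA [(1 + _) * _]mulrC inv1sqrE mul1r.
Qed.

Lemma weighted_packet_integral c :
  lebn.-integrable setT (fun xi => (\prod_(i < n) inv1sqr (xi ord0 i - c ord0 i))%:E) /\
  \int[lebn]_xi (\prod_(i < n) inv1sqr (xi ord0 i - c ord0 i)) = pi ^+ n.
Proof.
have sh (a : R) := integrable_shift a (@continuous_inv1sqr R)
  (fun=> ltW (inv1sqr_gt0 _)) integrable_inv1sqr.
have [|i e] := @Rint_rV_prod R n (fun i (t : R) => inv1sqr (t - c ord0 i)).
  by move=> i; have [] := sh (c ord0 i).
split => //; rewrite e -[X in _ ^+ X](card_ord n) -prodr_const.
apply: eq_bigr => j _; have [_ ->] := sh (c ord0 j).
by rewrite /Rintegral integral_inv1sqr.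
Qed.

Lemma fourier_envelope xi c :
  Cintg lebn setT (fun x => (envelope x)%:C * cexpi (- dotp x (xi - c))) /\
  Cint lebn setT (fun x => (envelope x)%:C * cexpi (- dotp x (xi - c))) = (packet c xi)%:C.
Proof.
have E x : (envelope x)%:C * cexpi (- dotp x (xi - c)) =
    \prod_(i < n) ((exp_tent (x ord0 i))%:C * cexpi (- (x ord0 i * (xi ord0 i - c ord0 i)))).
  rewrite big_split /= -rmorph_prod -cexpi_sum; congr (_ * cexpi _).
  by rewrite sumrN; congr (- _); apply: eq_bigr => i _; rewrite !mxE.
have [|i e] := @Cint_rV_prod R n (fun i (t : R) =>
  (exp_tent t)%:C * cexpi (- (t * (xi ord0 i - c ord0 i)))).
  by move=> i; exact: Cintg_exp_tent.
split; first by under eq_fun do rewrite E.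
under eq_fun do rewrite E.
rewrite e /packet rmorph_prod; apply: eq_bigr => j _; exact: fourier_exp_tent.
Qed.

(* Exchanging the integrals moves the Fourier transform from a Schwartz function
   to the modulated envelope, so that no inversion formula is needed. *)
Lemma packet_fourier_is c phi : schwartz phi ->
  Cintg lebn setT (fun xi => (packet c xi)%:C * phi xi) /\
  Cint lebn setT (fun x => (envelope x)%:C * cexpi (dotp x c) * fourier phi x) =
  Cint lebn setT (fun xi => (packet c xi)%:C * phi xi).
Proof.
move=> sphi; have mphi := schwartz_Cmeas sphi; have iphi := schwartz_integrable sphi.
pose A x := (envelope x)%:C * cexpi (dotp x c).
have mA : Cmeas setT A.
  apply: CmeasM; first by apply: Cmeas_real; exact: measurable_envelope.
  by apply: Cmeas_cexpi; exact: measurable_dotpl.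
have iA : Cintg lebn setT A.
  apply: (Cintg_dom measurableT mA) integrable_envelope _ => x _.
  rewrite ComplexField.Normc.normcM normc_cexpi mulr1 normc_real.
  by rewrite ger0_norm ?envelope_ge0.
pose F (z : 'rV[R]_n * 'rV[R]_n) := A z.1 * phi z.2 * cexpi (- dotp z.2 z.1).
have mE : Cmeas setT (fun z : 'rV[R]_n * 'rV[R]_n => cexpi (- dotp z.2 z.1)).
  apply: Cmeas_cexpi; apply: measurableT_comp; first exact: oppr_measurable.
  by apply: measurable_dotp => i; [exact: measurable_snd_coord|exact: measurable_fst_coord].
have iF : Cintg (lebn \x lebn)%E setT F.
  by apply: CintgM_tensor => // z; rewrite normc_cexpi.
have me x : Cmeas setT (fun xi => cexpi (- dotp xi x)).
  apply: Cmeas_cexpi; apply: measurableT_comp; first exact: oppr_measurable.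
  exact: measurable_dotpl.
have i1 x : Cintg lebn setT (fun xi => phi xi * cexpi (- dotp xi x)).
  apply: (Cintg_dom measurableT) (Cintg_normc measurableT iphi) _.
    exact: CmeasM.
  by move=> xi _; rewrite ComplexField.Normc.normcM normc_cexpi mulr1.
have F1 x : (fun xi => F (x, xi)) = (fun xi => A x * (phi xi * cexpi (- dotp xi x))).
  by apply/funext => xi; rewrite /F /= mulrA.
have F2 xi : (fun x => F (x, xi)) =
    (fun x => phi xi * ((envelope x)%:C * cexpi (- dotp x (xi - c)))).
  apply/funext => x; rewrite /F /A /= dotpBr opprB cexpiD [dotp xi x]dotpC.
  by ring.
split.
  apply: (Cintg_dom measurableT) (Cintg_normc measurableT iphi) _.
    apply: CmeasM => //; apply: Cmeas_real.
    by apply/measurable_EFinP; exact: measurable_int (packet_integral c).1.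
  move=> xi _; rewrite ComplexField.Normc.normcM normc_real ger0_norm ?packet_ge0//.
  rewrite ler_piMl ?normc_ge0// -[leRHS](_ : \prod_(i < n) 1 = 1); last by rewrite big1.
  apply: ler_prod => i _; rewrite sqr_ge0 expr_le1//= ?inv1sqr_le1//.
  exact/ltW/inv1sqr_gt0.
transitivity (Cint lebn setT (fun x => Cint lebn setT (fun xi => F (x, xi)))).
  by apply: eq_Cint => x _; rewrite F1 CintZ.
have iF1 x : Cintg lebn setT (fun xi => F (x, xi)).
  by rewrite F1; exact: CintgZ.
have [_ <-] := Cint_fubini1 iF iF1.
rewrite Cint_fubini2//; last first.
  by move=> xi; rewrite F2; apply: CintgZ => //; have [] := fourier_envelope xi c.
apply: eq_Cint => xi _; rewrite F2 CintZ//; last by have [] := fourier_envelope xi c.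
by have [_ ->] := fourier_envelope xi c; rewrite mulrC.
Qed.

End wave_packets.

(** * Bounded overlap of unit-spaced bumps *)

Section schur.
Context {R : realType}.
Implicit Types (y t : R).

(** The function [t / (1 + |t|)] is increasing and bounded, with unit increments comparable to
    [inv1sqr]; it replaces the comparison of a sum with an integral. *)
Lemma inv1sqr_telescope t :
  inv1sqr t <= 4 * ((t + 1) / (1 + `|t + 1|) - t / (1 + `|t|)).
Proof.
rewrite /inv1sqr; have d0 : 0 < 1 + t ^+ 2 by rewrite ltr_pwDl// sqr_ge0.
have [t0|t0] := leP 0 t.
  rewrite !ger0_norm ?addr_ge0//.
  rewrite (_ : _ - _ = ((1 + t) * (2 + t))^-1); last by field; lra.
  by rewrite -div1r ler_pdivrMr// mulrAC ler_pdivlMr ?mulr_gt0//; nra.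
have [t1|t1] := leP 0 (t + 1).
  rewrite (ger0_norm t1) (ltr0_norm t0).
  rewrite (_ : _ - _ = ((t + 1) * (1 - t) - t * (2 + t)) / ((2 + t) * (1 - t))); last first.
    by field; rewrite -?lt0r_neq0 //; lra.
  by rewrite -div1r ler_pdivrMr// mulrA mulrAC ler_pdivlMr ?mulr_gt0//; nra.
rewrite (ltr0_norm t1) (ltr0_norm t0).
rewrite (_ : _ - _ = ((- t) * (1 - t))^-1); last by field; lra.
by rewrite -div1r ler_pdivrMr// mulrAC ler_pdivlMr ?mulr_gt0//; nra.
Qed.

(** After telescoping, the two end values lie in [[-1, 1]], so the bound is 4 times 2 whatever [J]
    is. *)
Lemma sum_inv1sqr_le (J : nat) y : \sum_(j < J) inv1sqr (y - j%:R) <= 8.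
Proof.
pose F t := t / (1 + `|t|).
have F1 t : `|F t| <= 1.
  by rewrite normrM normfV (ger0_norm (_ : 0 <= 1 + `|t|)) ?addr_ge0// ler_pdivrMr ?ltr_pwDl//; lra.
apply: (@le_trans _ _ (4 * (F (y + 1) - F (y + 1 - J%:R)))); last first.
  have := F1 (y + 1); have := F1 (y + 1 - J%:R); rewrite !ler_norml.
  by move=> /andP[? ?] /andP[? ?]; lra.
elim: J => [|J IHJ]; first by rewrite big_ord0 subr0 subrr mulr0.
rewrite big_ord_recr /= (le_trans (lerD IHJ (inv1sqr_telescope _)))//.
rewrite -/(F _) -/(F _) (_ : y - J%:R + 1 = y + 1 - J%:R); last by ring.
rewrite (_ : y - J%:R = y + 1 - J.+1%:R); last by rewrite -natr1; ring.
by lra.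
Qed.

End schur.

(** * Sums of packets and their Sobolev norm *)

Section wave_trains.
Context {R : realType} {n : nat}.
Notation lebn := (@lebesgue_rV R n).
Variables (J : nat) (c : 'I_J -> 'rV[R]_n).
Implicit Types (x xi : 'rV[R]_n).

Definition train_hat xi : R := \sum_(j < J) packet (c j) xi.

Definition train_dist (psi : 'rV[R]_n -> R[i]) : R[i] :=
  \sum_(j < J) Cint lebn setT (fun x => (envelope x)%:C * cexpi (dotp x (c j)) * psi x).

Lemma measurable_packet (a : 'rV[R]_n) : measurable_fun setT (packet a).
Proof. by apply/measurable_EFinP; exact: measurable_int (packet_integral a).1. Qed.

Lemma measurable_train_hat : measurable_fun setT train_hat.
Proof. by apply: measurable_sum => j; exact: measurable_packet. Qed.

Lemma train_hat_ge0 xi : 0 <= train_hat xi.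
Proof. by apply: sumr_ge0 => j _; exact: packet_ge0. Qed.

(** The distribution has order zero: as [envelope] is integrable, a uniform bound on the test
    function suffices. *)
Lemma train_dist_tempered : tempered_distribution train_dist.
Proof.
have me j : Cmeas setT (fun x => (envelope x)%:C * cexpi (dotp x (c j))).
  apply: CmeasM; first by apply: Cmeas_real; exact: measurable_envelope.
  by apply: Cmeas_cexpi; exact: measurable_dotpl.
have B phi M j x : schwartz_bound phi 0 M ->
    normc ((envelope x)%:C * cexpi (dotp x (c j)) * phi x) <= M * envelope x.
  move=> /(@schwartz_bound0 _ _ phi 0 M x); rewrite expr0 mul1r => h.
  rewrite !ComplexField.Normc.normcM normc_cexpi mulr1 normc_real.
  by rewrite ger0_norm ?envelope_ge0// mulrC ler_wpM2r// envelope_ge0.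
have iM M : lebn.-integrable setT (EFin \o (fun x => M * envelope x)).
  rewrite (_ : _ \o _ = (fun x => M%:E * (envelope x)%:E)%E)//.
  by apply: integrableZl => //; exact: integrable_envelope.
have I phi j : schwartz phi ->
    Cintg lebn setT (fun x => (envelope x)%:C * cexpi (dotp x (c j)) * phi x).
  move=> sphi; have [_ /(_ 0%N)[M HM]] := sphi.
  apply: (Cintg_dom measurableT _ (iM M)) => [|x _]; last exact: B.
  by apply: CmeasM => //; exact: schwartz_Cmeas.
split=> [a phi psi sphi spsi|].
  rewrite /train_dist mulr_sumr -big_split; apply: eq_bigr => j _ /=.
  rewrite -CintZ//; last exact: I.
  rewrite -CintD//; [|by apply: CintgZ => //; exact: I|exact: I].
  by apply: eq_Cint => x _; ring.
exists 0%N, (J%:R * (2 * \int[lebn]_x envelope x)) => phi M sphi HM.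
apply: le_trans (normc_sum _ _ _) _.
apply: (@le_trans _ _ (\sum_(j < J) (2 * \int[lebn]_x envelope x) * M)).
  apply: ler_sum => j _; apply: le_trans (normc_Cint_le measurableT (I _ _ sphi)) _.
  rewrite -mulrA ler_wpM2l// mulrC -RintegralZl//; last exact: integrable_envelope.
  apply: le_Rintegral => //; last by move=> x _; exact: B.
  exact: Cintg_normc (I _ _ sphi).
by rewrite sumr_const card_ord -[leLHS]mulr_natl mulrA.
Qed.

Lemma train_fourier_is : fourier_is train_dist (fun xi => (train_hat xi)%:C).
Proof.
split; first exact: Cmeas_real measurable_train_hat.
move=> phi sphi.
have E : (fun xi => (train_hat xi)%:C * phi xi) =
    (fun xi => \sum_(j < J) (packet (c j) xi)%:C * phi xi).
  by apply/funext => xi; rewrite -mulr_suml rmorph_sum.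
rewrite E; split; first by apply: Cintg_sum => // j; have [] := packet_fourier_is (c j) sphi.
rewrite -[RHS]/(Cint lebn setT (fun xi =>
  \sum_(j < J) (packet (c j) xi)%:C * phi xi)) Cint_sum//; last by move=> j;
    have [] := packet_fourier_is (c j) sphi.
by apply: eq_bigr => j _; have [] := packet_fourier_is (c j) sphi.
Qed.

Lemma packet_le_coord (a : 'rV[R]_n) i xi : packet a xi <= inv1sqr (xi ord0 i - a ord0 i).
Proof.
have q (t : R) : 0 <= inv1sqr t ^+ 2 <= 1.
  by rewrite sqr_ge0 expr_le1//= ?inv1sqr_le1//; exact/ltW/inv1sqr_gt0.
rewrite /packet (bigD1 i)//= (@le_trans _ _ (inv1sqr (xi ord0 i - a ord0 i) ^+ 2))//.
  rewrite ler_piMr ?sqr_ge0// -[leRHS](_ : \prod_(j < n | j != i) 1 = 1); last by rewrite big1.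
  by apply: ler_prod => j _; exact: q.
by rewrite expr2 ler_piMr ?inv1sqr_le1//; exact/ltW/inv1sqr_gt0.
Qed.

Variables (i0 : 'I_n) (N : R).
Hypothesis c_spaced : forall j, c j ord0 i0 = N + j%:R.

Lemma train_hat_le xi : train_hat xi <= 8.
Proof.
apply: le_trans (_ : \sum_(j < J) inv1sqr ((xi ord0 i0 - N) - j%:R) <= _).
  apply: ler_sum => j _; rewrite (le_trans (packet_le_coord _ i0 _))// c_spaced.
  by rewrite opprD addrA.
exact: sum_inv1sqr_le.
Qed.

(** One factor of the squared transform is replaced by its supremum, at most 8 by bounded overlap,
    and the other is integrated. The result is linear in [J], where expanding the square crudely
    would give [J ^ 2]. The exponent [sg] stands in for a possibly negative [s]. *)
Lemma train_sobolev_le (s sg A : R) : s <= sg -> 0 <= sg -> sg <= 1 -> 1 <= A ->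
  (forall j xi, 1 + sqnorm xi <= A * \prod_(i < n) (1 + (xi ord0 i - c j ord0 i) ^+ 2)) ->
  (sobolev_sqnorm s (fun xi => (train_hat xi)%:C) <=
   ((2 * pi) ^- n * (8 * A `^ sg * (J%:R * pi ^+ n)))%:E)%E.
Proof.
move=> ssg sg0 sg1 A1 HA; rewrite /sobolev_sqnorm [leRHS]EFinM.
apply: lee_pmul => //.
- by rewrite lee_fin invr_ge0 exprn_ge0// mulr_ge0// pi_ge0.
- by apply: integral_ge0 => xi _; rewrite lee_fin mulr_ge0 ?powR_ge0 ?sqr_ge0.
pose W j xi : R := \prod_(i < n) inv1sqr (xi ord0 i - c j ord0 i).
have iW j : lebn.-integrable setT (fun xi => (W j xi)%:E).
  by have [] := weighted_packet_integral (c j).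
have sW : (\int[lebn]_xi (8 * A `^ sg * \sum_(j < J) W j xi)%:E =
    (8 * A `^ sg * (J%:R * pi ^+ n))%:E)%E.
  under eq_integral do rewrite EFinM -sumEFin.
  rewrite integralZl//; last by apply: integrable_sum => // j _; exact: iW.
  rewrite integral_sum//= [RHS]EFinM; congr (_ * _)%E.
  rewrite (eq_bigr (fun=> (pi ^+ n)%:E)); last first.
    move=> j _; have [_ <-] := weighted_packet_integral (c j).
    by rewrite /Rintegral fineK//; apply: integrable_fin_num => //; exact: iW.
  by rewrite sumEFin sumr_const card_ord mulr_natl.
rewrite -sW; apply: ge0_le_integral => //.
- by move=> xi _; rewrite lee_fin mulr_ge0 ?powR_ge0 ?sqr_ge0.
- apply/measurable_EFinP; apply: measurable_funM.
    apply: (measurableT_comp (measurable_powR _)).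
    apply: measurable_funD => //; apply: measurable_dotp => i; exact: measurable_rV_coord.
  apply: measurable_funX; apply: measurable_normc; apply: Cmeas_real.
  exact: measurable_train_hat.
- apply/measurable_EFinP; apply: measurable_funM => //; apply: measurable_sum => j.
  by apply/measurable_EFinP; exact: measurable_int (iW j).
move=> xi _; rewrite lee_fin normc_real ger0_norm ?train_hat_ge0//.
have q0 := sqnorm_ge0 xi; have A0 : 0 <= A by exact: le_trans A1.
have h1 : (1 + sqnorm xi) `^ s <= (1 + sqnorm xi) `^ sg by rewrite ler_powR// lerDl.
have h2 j : (1 + sqnorm xi) `^ sg * packet (c j) xi <= A `^ sg * W j xi.
  set w := \prod_(i < n) (1 + (xi ord0 i - c j ord0 i) ^+ 2).
  have w1 : 1 <= w.
    rewrite -[leLHS](_ : \prod_(i < n) 1 = 1); last by rewrite big1.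
    by apply: ler_prod => i _; rewrite ler01 lerDl sqr_ge0.
  have w0 : 0 <= w by exact: le_trans w1.
  rewrite /W -weighted_packetE -/w mulrA ler_wpM2r ?packet_ge0//.
  apply: (@le_trans _ _ ((A * w) `^ sg)).
    by apply: ge0_ler_powR; rewrite ?nnegrE ?addr_ge0 ?mulr_ge0 ?HA.
  (* As [w >= 1] and [sg <= 1], [w ^ sg] is at most [w], the weight that the packet can absorb. *)
  rewrite powRM// ler_wpM2l ?powR_ge0// -[leRHS]powRr1//.
  by rewrite ler_powR.
rewrite expr2 mulrA [leRHS](_ : _ = \sum_(j < J) A `^ sg * W j xi * 8); last first.
  by rewrite -mulr_suml -mulr_sumr; ring.
rewrite -mulr_suml; apply: ler_pM; rewrite ?mulr_ge0 ?powR_ge0 ?train_hat_ge0//.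
  rewrite /train_hat mulr_sumr; apply: ler_sum => j _; apply: le_trans (h2 j).
  by rewrite ler_wpM2r// packet_ge0.
exact: train_hat_le.
Qed.

End wave_trains.

(** * Pairings with test functions *)

Section pairings.
Context {R : realType} {n : nat}.
Notation lebn := (@lebesgue_rV R n).
Implicit Types (x xi : 'rV[R]_n).

Lemma measurable_meval (P : mpoly n R) :
  measurable_fun setT (fun xi : 'rV[R]_n => meval (fun i => xi ord0 i) P).
Proof.
under eq_fun do rewrite mevalE.
apply: measurable_sum => m; apply: measurable_funM => //; apply: measurable_prod => i _.
by apply: measurable_funX; exact: measurable_rV_coord.
Qed.

Lemma Rint_tensor d1 d2 (T1 : measurableType d1) (T2 : measurableType d2)
    (m1 : {sigma_finite_measure set T1 -> \bar R})
    (m2 : {sigma_finite_measure set T2 -> \bar R}) (f : T1 -> R) (g : T2 -> R) :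
  m1.-integrable setT (EFin \o f) -> m2.-integrable setT (EFin \o g) ->
  \int[(m1 \x m2)%E]_z (f z.1 * g z.2) = \int[m1]_u f u * \int[m2]_y g y.
Proof.
move=> if_ ig.
have cf : Cintg m1 setT (fun u => (f u)%:C) by split => //; exact: integrable0.
have cg : Cintg m2 setT (fun u => (g u)%:C) by split => //; exact: integrable0.
have [_] := Cint_tensor cf cg; rewrite !Cint_real => h.
apply: complexI; rewrite rmorphM /= -h -Cint_real; apply: eq_Cint => z _.
by rewrite rmorphM.
Qed.

Lemma measurable_unit_ball : measurable (@unit_ball R n).
Proof.
have m : measurable_fun setT (fun x : 'rV[R]_n => Num.sqrt (sqnorm x)).
  apply: measurableT_comp.
    by apply: continuous_measurable_fun; exact: sqrt_continuous.
  by apply: measurable_dotp => i; exact: measurable_rV_coord.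
have := m measurableT _ (measurable_itv `]-oo, 1[); rewrite setTI.
rewrite (_ : _ @^-1` _ = @unit_ball R n)//.
Qed.

Section lower_bound.
Variables (J : nat) (c : 'I_J -> 'rV[R]_n) (P : mpoly n R) (t theta0 eps : R).
Variable psi : 'rV[R]_n -> R.
Hypothesis psi_int : lebn.-integrable setT (EFin \o psi).
Hypothesis psi_ge0 : forall x, 0 <= psi x.
Let phase xi x := meval (fun i => xi ord0 i) P * t + dotp x xi.
Hypothesis phase_le : forall j xi x, psi x != 0 ->
  normc (cexpi (phase xi x) - cexpi theta0) <=
  eps * \prod_(i < n) (1 + (xi ord0 i - c j ord0 i) ^+ 2).

(** Freezing the phase at [theta0], common to all [j] and to the support of [psi], turns the double
    integral into a product of modulus [J H ^ n I], with no cancellation between packets. The error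
    carries the weight and is integrated against the packets; its factor 2 comes from
    [normc_Cint_le]. *)
Lemma propagator_pairing_ge :
  (2 * pi) ^- n * (J%:R * \int[lebn]_x psi x *
    ((\int[@lebesgue_measure R]_y (inv1sqr y ^+ 2)) ^+ n - 2 * eps * pi ^+ n)) <=
  normc (propagator P t (fun xi => (train_hat c xi)%:C) (fun x => (psi x)%:C)).
Proof.
rewrite /propagator ComplexField.Normc.normcM normc_real ger0_norm; last first.
  by rewrite invr_ge0 exprn_ge0// mulr_ge0// pi_ge0.
rewrite ler_wpM2l ?invr_ge0 ?exprn_ge0 ?mulr_ge0 ?pi_ge0//.
set I := \int[lebn]_x psi x; set H := \int[_]_y _.
have mpsi : measurable_fun setT psi by apply/measurable_EFinP; exact: measurable_int psi_int.
have I0 : 0 <= I by exact: Rintegral_ge0.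
have ih : lebn.-integrable setT (EFin \o train_hat c).
  rewrite (_ : _ \o _ = (fun xi => \sum_(j < J) (packet (c j) xi)%:E)%E); last first.
    by apply/funext => xi; rewrite /= /train_hat sumEFin.
  by apply: integrable_sum => // j _; have [] := packet_integral (c j).
have hE : \int[lebn]_xi train_hat c xi = J%:R * H ^+ n.
  rewrite /Rintegral; under eq_integral do rewrite /train_hat -sumEFin.
  rewrite integral_sum//=; last by move=> j; have [] := packet_integral (c j).
  rewrite (eq_bigr (fun=> (H ^+ n)%:E)); last first.
    move=> j _; have [ij <-] := packet_integral (c j).
    by rewrite /Rintegral fineK//; exact: integrable_fin_num.
  by rewrite sumEFin sumr_const card_ord mulr_natl.
pose W j xi : R := \prod_(i < n) inv1sqr (xi ord0 i - c j ord0 i).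
have iW : lebn.-integrable setT (EFin \o (fun xi => \sum_(j < J) W j xi)).
  rewrite (_ : _ \o _ = (fun xi => \sum_(j < J) (W j xi)%:E)%E); last first.
    by apply/funext => xi; rewrite /= sumEFin.
  by apply: integrable_sum => // j _; have [] := weighted_packet_integral (c j).
have WE : \int[lebn]_xi (\sum_(j < J) W j xi) = J%:R * pi ^+ n.
  rewrite /Rintegral; under eq_integral do rewrite -sumEFin.
  rewrite integral_sum//=; last by move=> j; have [] := weighted_packet_integral (c j).
  rewrite (eq_bigr (fun=> (pi ^+ n)%:E)); last first.
    move=> j _; have [ij <-] := weighted_packet_integral (c j).
    by rewrite /Rintegral fineK//; exact: integrable_fin_num.
  by rewrite sumEFin sumr_const card_ord mulr_natl.
have ch : Cintg lebn setT (fun xi => (train_hat c xi)%:C) by split => //; exact: integrable0.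
have cpsi : Cintg lebn setT (fun x => (psi x)%:C) by split => //; exact: integrable0.
pose F (z : 'rV[R]_n * 'rV[R]_n) :=
  (train_hat c z.1)%:C * (psi z.2)%:C * cexpi (phase z.1 z.2).
pose G (z : 'rV[R]_n * 'rV[R]_n) := cexpi theta0 * ((train_hat c z.1)%:C * (psi z.2)%:C).
have mphase : measurable_fun setT (fun z : 'rV[R]_n * 'rV[R]_n => phase z.1 z.2).
  apply: measurable_funD.
    apply: measurable_funM => //.
    exact: (measurableT_comp (measurable_meval P) measurable_fst).
  by apply: measurable_dotp => i; [exact: measurable_snd_coord|exact: measurable_fst_coord].
have iF : Cintg (lebn \x lebn)%E setT F.
  apply: (CintgM_tensor (E := fun z => cexpi (phase z.1 z.2)) ch cpsi).
    exact: Cmeas_cexpi mphase.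
  by move=> z; rewrite normc_cexpi.
have [iG1 G1E] := Cint_tensor ch cpsi.
have iG : Cintg (lebn \x lebn)%E setT G by exact: CintgZ.
have GE : normc (Cint (lebn \x lebn)%E setT G) = J%:R * H ^+ n * I.
  rewrite CintZ// G1E !Cint_real !ComplexField.Normc.normcM normc_cexpi mul1r !normc_real.
  rewrite hE !ger0_norm// mulr_ge0// exprn_ge0// Rintegral_ge0// => x _.
  exact: sqr_ge0.
have iFx xi : Cintg lebn setT (fun x => F (xi, x)).
  apply: (Cintg_dom measurableT) (Cintg_normc measurableT (CintgZ measurableT (train_hat c
    xi)%:C cpsi)) _.
    apply: CmeasM; first exact: (CmeasM (Cmeas_cst _ (train_hat c xi)%:C) (Cmeas_real mpsi)).
    apply: (Cmeas_cexpi (f := fun x => meval (fun i => xi ord0 i) P * t + dotp x xi)).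
    by apply: measurable_funD => //; exact: measurable_dotpl.
  by move=> x _; rewrite /F !ComplexField.Normc.normcM normc_cexpi mulr1.
have [_ VE] := Cint_fubini1 iF iFx.
(* Unfolding [fourier] at [- xi] restores the factor [exp (i x . xi)] and gives the double integral
   of [F]. *)
have -> : Cintegral setT (fun xi => (train_hat c xi)%:C *
    cexpi (meval (fun i => xi ord0 i) P * t) * fourier (fun x => (psi x)%:C) (- xi)) =
    Cint (lebn \x lebn)%E setT F.
  rewrite VE; apply: eq_Cint => xi _.
  rewrite -[fourier _ _]/(Cint lebn setT _) -CintZ//; last first.
    apply: (Cintg_dom measurableT) psi_int _.
      apply: CmeasM; first exact: Cmeas_real.
      apply: Cmeas_cexpi; apply: measurableT_comp; first exact: oppr_measurable.
      exact: measurable_dotpl.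
    by move=> x _; rewrite ComplexField.Normc.normcM normc_cexpi mulr1 normc_real ger0_norm.
  apply: eq_Cint => x _; rewrite /F /phase /= cexpiD.
  have -> : dotp x (- xi) = - dotp x xi.
    by rewrite /dotp -sumrN; apply: eq_bigr => i _; rewrite !mxE mulrN.
  by rewrite opprK; ring.
have dFG : normc (Cint (lebn \x lebn)%E setT F - Cint (lebn \x lebn)%E setT G) <=
    2 * (eps * (J%:R * pi ^+ n * I)).
  have iD : Cintg (lebn \x lebn)%E setT (fun z => F z + (-1) * G z).
    by apply: CintgD => //; exact: CintgZ.
  rewrite -mulN1r -CintZ// -CintD//; last exact: CintgZ.
  apply: le_trans (normc_Cint_le measurableT iD) _.
  rewrite ler_wpM2l// -WE -Rint_tensor// -RintegralZl//; last exact: integrable_tensor iW psi_int.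
  apply: le_Rintegral => //; first exact: Cintg_normc.
    rewrite (_ : _ \o _ = (fun z => eps%:E * ((\sum_(j < J) W j z.1) * psi z.2)%:E)%E)//.
    exact: (integrableZl measurableT eps (integrable_tensor iW psi_int)).
  move=> [xi x] _.
  have -> : F (xi, x) + (-1) * G (xi, x) =
      (train_hat c xi * psi x)%:C * (cexpi (phase xi x) - cexpi theta0).
    by rewrite /F /G /= rmorphM /=; ring.
  rewrite ComplexField.Normc.normcM normc_real ger0_norm ?mulr_ge0 ?train_hat_ge0//.
  have [->|px] := eqVneq (psi x) 0; first by rewrite !mulr0 mul0r.
  rewrite mulrAC mulrA ler_wpM2r// /train_hat mulr_suml mulr_sumr.
  apply: ler_sum => j _; rewrite /W -weighted_packetE mulrC mulrA.
  by rewrite ler_wpM2r ?packet_ge0// phase_le.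
have := le_normcD (Cint (lebn \x lebn)%E setT F)
  (- (Cint (lebn \x lebn)%E setT F - Cint (lebn \x lebn)%E setT G)).
rewrite normcN opprB addrC subrK GE => h.
rewrite [leLHS](_ : _ = J%:R * H ^+ n * I - 2 * (eps * (J%:R * pi ^+ n * I))); last by ring.
by rewrite lerBlDr (le_trans h)// lerD2l.
Qed.

End lower_bound.

(** The maximal function is linearised: each [psi l] has its own time, every modulus at that time is
    below the supremum, and the [psi l] add up to at most 1. *)
Lemma maximal_pairing_sum (P : mpoly n R) uhat (M : R) : maximal_L1_le P uhat M ->
  forall (L : finType) (t : L -> R) (psi : L -> 'rV[R]_n -> R),
  (forall l, 0 < t l < 1) ->
  (forall l, test_function (@unit_ball R n) (fun x => (psi l x)%:C)) ->
  (forall l, measurable_fun setT (psi l)) ->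
  (forall l x, 0 <= psi l x) -> (forall x, \sum_l psi l x <= 1) ->
  \sum_l normc (propagator P (t l) uhat (fun x => (psi l x)%:C)) <= 2 * M.
Proof.
move=> [F [FP mS SM]] L t psi t01 tpsi mpsi psi0 psi1.
have mB := measurable_unit_ball.
have S0 x : (0 <= sup_modulus F x)%E.
  (* Some time in the open interval must be exhibited: the supremum of an empty set would be
     [-oo]. *)
  apply: le_trans (_ : (normc (F 2^-1 x))%:E <= _)%E; first by rewrite lee_fin normc_ge0.
  by apply: ereal_sup_ubound; exists 2^-1 => //=; rewrite in_itv/= invr_gt0 invf_lt1//= ltr1n ltr0n.
have psi_le1 l x : psi l x <= 1.
  by rewrite (le_trans _ (psi1 x))// (bigD1 l)//= lerDl sumr_ge0.
have mp l : measurable_fun (@unit_ball R n) (psi l) by exact: measurable_funTS.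
have iFp l : Cintg lebn (@unit_ball R n) (fun x => F (t l) x * (psi l x)%:C).
  have [iF _] := FP _ (t01 l).
  apply: (Cintg_dom mB) (Cintg_normc mB iF) _.
    by apply: CmeasM; [exact: Cintg_meas iF|exact: Cmeas_real].
  move=> x _; rewrite ComplexField.Normc.normcM normc_real ger0_norm//.
  by rewrite ler_piMr ?normc_ge0.
have step l : ((normc (propagator P (t l) uhat (fun x => (psi l x)%:C)))%:E <=
    2%:E * \int[lebn]_(x in @unit_ball R n) (sup_modulus F x * (psi l x)%:E))%E.
  have [iF ->] := FP _ (t01 l); last exact: tpsi.
  apply: (@le_trans _ _ (2 * \int[lebn]_(x in @unit_ball R n) normc (F (t l) x * (psi l x)%:C))%:E).
    by rewrite lee_fin; exact: (normc_Cint_le mB (iFp l)).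
  have nF := Cintg_normc mB (iFp l).
  rewrite EFinM lee_wpmul2l ?lee_fin//.
  rewrite /Rintegral fineK; last exact: integrable_fin_num.
  apply: ge0_le_integral => //.
  - by move=> x _; rewrite lee_fin normc_ge0.
  - exact: measurable_int nF.
  - by apply: emeasurable_funM => //; exact/measurable_EFinP.
  move=> x _; rewrite ComplexField.Normc.normcM normc_real ger0_norm// EFinM.
  rewrite lee_wpmul2r ?lee_fin//; apply: ereal_sup_ubound; exists (t l) => //=.
  by rewrite in_itv/= t01.
rewrite -lee_fin -sumEFin; apply: le_trans (lee_sum _ (fun l _ => step l)) _.
rewrite -ge0_sume_distrr; last by move=> l _; apply: integral_ge0 => x _; rewrite mule_ge0 ?lee_fin.
rewrite EFinM lee_wpmul2l ?lee_fin// -ge0_integral_sum//; last 2 first.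
- by move=> l; apply: emeasurable_funM => //; exact/measurable_EFinP.
- by move=> l x _; rewrite mule_ge0 ?lee_fin.
apply: le_trans SM; apply: ge0_le_integral => //.
- by move=> x _; apply: sume_ge0 => l _; rewrite mule_ge0 ?lee_fin.
- apply: emeasurable_sum => l.
  by apply: emeasurable_funM => //; exact/measurable_EFinP.
move=> x _; rewrite -ge0_sume_distrr; last by move=> l _; rewrite lee_fin.
by rewrite sumEFin -[leRHS]mule1 lee_wpmul2l ?lee_fin.
Qed.

End pairings.

(** * Lower bound for the maximal function *)

Section growth.
Context {R : realType}.

Lemma normc_cexpiB_le (a b : R) : normc (cexpi a - cexpi b) <= 2 * `|a - b|.
Proof.
wlog ab : a b / a < b => [h|].
  have [/h//|ba|->] := ltgtP a b; last by rewrite !subrr ComplexField.Normc.normc0 normr0 mulr0.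
  by rewrite -normcN opprB distrC h.
have lip (f f' : R -> R) : (forall x : R, is_derive x 1 f (f' x)) ->
    (forall x, `|f' x| <= 1) -> `|f a - f b| <= `|a - b|.
  move=> df f1; have [|z _ e] := @MVT R f f' a b ab (fun x _ => df x).
    apply: continuous_subspaceT => x; apply: differentiable_continuous.
    by apply/derivable1_diffP; exact: (@ex_derive _ _ _ _ _ _ _ (df x)).
  by rewrite distrC e normrM [leRHS]distrC ler_piMl.
apply: le_trans (normc_le_ReIm _) _; rewrite mulr_natl mulr2n; apply: lerD => /=.
  apply: (lip _ (fun x => - sin x)) => x.
  by rewrite normrN ler_norml sin_geN1 sin_le1.
apply: (lip _ cos) => x.
by rewrite ler_norml cos_geN1 cos_le1.
Qed.

(** The grid fills the negative side of the origin, so that the times attached to its cubes are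
    positive. *)
Definition grid_corner (r : R) (q : nat) : R := - (r * q.+1%:R).

Lemma sum_interval_bump_le1 (m : nat) (r y : R) : 0 < r ->
  \sum_(q < m) interval_bump (grid_corner r q) r y <= 1.
Proof.
move=> r0; have [q0 hq0|none] := pickP (fun q : 'I_m =>
  interval_bump (grid_corner r q) r y != 0); last first.
  by rewrite big1// => q _; apply/eqP/negbFE/none.
rewrite (bigD1 q0)//= big1 ?addr0 ?interval_bump_le1// => q qq0.
apply/eqP/negPn/negP => hq.
have /andP[] := interval_bump_neq0 r0 hq; have /andP[] := interval_bump_neq0 r0 hq0.
rewrite /grid_corner => h1 h2 h3 h4.
have : (q.+1%:R : R) < q0.+1%:R + 1.
  by rewrite -(ltr_pM2l r0) mulrDr mulr1; lra.
have : (q0.+1%:R : R) < q.+1%:R + 1.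
  by rewrite -(ltr_pM2l r0) mulrDr mulr1; lra.
rewrite !natr1 !ltr_nat !ltnS => h5 h6.
by move/eqP : qq0; apply; apply/val_inj/eqP; rewrite eqn_leq; apply/andP.
Qed.

(** By distributivity the sum over cubes is the product over coordinates of one-dimensional sums. *)
Lemma sum_cube_bump_le1 (n m : nat) (r : R) (x : 'rV[R]_n) : 0 < r ->
  \sum_(l : {ffun 'I_n -> 'I_m}) cube_bump (fun i => grid_corner r (l i)) r x <= 1.
Proof.
move=> r0; rewrite -(bigA_distr_bigA (fun (i : 'I_n) (q : 'I_m) =>
  interval_bump (grid_corner r q) r (x ord0 i))) /=.
rewrite -[leRHS](_ : \prod_(i < n) 1 = 1); last by rewrite big1.
apply: ler_prod => i _; rewrite sum_interval_bump_le1// andbT.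
by apply: sumr_ge0 => q _; exact: interval_bump_ge0.
Qed.

Lemma norm_dotp_le (n : nat) (x y : 'rV[R]_n) (a b : R) :
  (forall i, `|x ord0 i| <= a) -> (forall i, `|y ord0 i| <= b) ->
  `|dotp x y| <= n%:R * (a * b).
Proof.
move=> xa yb; apply: le_trans (ler_norm_sum _ _ _) _.
rewrite -[X in X%:R * _]card_ord mulr_natl -sumr_const; apply: ler_sum => i _.
by rewrite normrM ler_pM.
Qed.

Section train_growth.
Variables (n k : nat) (i0 i1 : 'I_n) (P Q : mpoly n R) (c1 c2 : R).
Hypotheses (k_gt1 : (1 < k)%N) (k_odd : odd k).
Hypotheses (i0E : nat_of_ord i0 = 0%N) (i1E : nat_of_ord i1 = 1%N).
Hypothesis P_deg : mmeasure mdeg P = k.+1.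
Hypotheses (c1_gt0 : 0 < c1) (c2_gt0 : 0 < c2).
Hypotheses (Q_form : Q \is ishomog1 k mdeg) (Q_vars : free_of_first 2 Q).
Hypothesis P_lead : pihomog mdeg k P =
  c1 *: mpolyX R (mnm1 i0) ^+ k + c2 *: mpolyX R (mnm1 i1) ^+ k + Q.

Let rho := (c2 / c1) `^ k%:R^-1.

Let rho_gt0 : 0 < rho. Proof. by rewrite powR_gt0// divr_gt0. Qed.

Let c2E : c2 = c1 * rho ^+ k.
Proof.
rewrite -powR_mulrn ?(ltW rho_gt0)// /rho -powRrM mulVf ?pnatr_eq0 -?lt0n ?(ltnW k_gt1)//.
by rewrite powRr1 ?divr_ge0 ?ltW//; field; rewrite gt_eqF.
Qed.

Let b := 3 + 3 / rho.

(* On this line, [c1 xi0 ^ k + c2 xi1 ^ k = c1 ((N + j) ^ k - (N - j) ^ k)] is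
   odd in [j]. *)
Definition train_center (N : R) (j : nat) : 'rV[R]_n :=
  \row_i (if i == i0 then N + j%:R else if i == i1 then (j%:R - N) / rho else 0).

Lemma train_center0 N j : train_center N j ord0 i0 = N + j%:R.
Proof. by rewrite mxE eqxx. Qed.

Let i01 : i1 == i0 = false.
Proof. by apply/negbTE/eqP => e; move: i1E; rewrite e i0E. Qed.

Lemma train_center1 N j : train_center N j ord0 i1 = (j%:R - N) / rho.
Proof. by rewrite mxE i01 eqxx. Qed.

Lemma train_center2 N j i : i != i0 -> i != i1 -> train_center N j ord0 i = 0.
Proof. by rewrite mxE => /negbTE -> /negbTE ->. Qed.

Lemma train_center_le N j i : 1 <= N -> j%:R <= N -> `|train_center N j ord0 i| <= b * N.
Proof.
move=> N1 jN; have r0 : 0 < rho^-1 by rewrite invr_gt0.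
have q0 : 0 <= N * rho^-1 by rewrite mulr_ge0 ?(ltW r0)// (le_trans ler01).
have jr : j%:R * rho^-1 <= N * rho^-1 by rewrite ler_wpM2r// ltW.
have jr0 : 0 <= j%:R * rho^-1 by rewrite mulr_ge0// ltW.
have j0 : 0 <= j%:R :> R by [].
have bN : b * N = 3 * N + 3 * (N * rho^-1) by rewrite /b; ring.
rewrite mxE bN; case: ifP => _; first by rewrite ger0_norm; lra.
case: ifP => _; last by rewrite normr0; lra.
by rewrite mulrBl ler_norml; apply/andP; split; lra.
Qed.

Lemma sqnorm_train_center N j (xi : 'rV[R]_n) : 1 <= N -> j%:R <= N ->
  1 + sqnorm xi <= (2 + 2 * n%:R * b ^+ 2) * N ^+ 2 *
    \prod_(i < n) (1 + (xi ord0 i - train_center N j ord0 i) ^+ 2).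
Proof.
move=> N1 jN; have := fun i => train_center_le i N1 jN.
move: (train_center N j) => a aN; have := prod1Dsqr_ge (xi - a); set w := \prod_(i < n) _.
have -> : w = \prod_(i < n) (1 + (xi ord0 i - a ord0 i) ^+ 2).
  by apply: eq_bigr => i _; rewrite !mxE.
rewrite -{1}/w => {w}; set w := \prod_(i < n) _ => hw.
have h : sqnorm xi <= 2 * sqnorm (xi - a) + n%:R * (2 * (b * N) ^+ 2).
  rewrite /sqnorm /dotp mulr_sumr -[X in X%:R * _]card_ord mulr_natl -sumr_const -big_split.
  apply: ler_sum => i _; have ha := aN i; rewrite /= !mxE.
  have : `|a ord0 i| ^+ 2 <= (b * N) ^+ 2 by rewrite lerXn2r ?nnegrE// (le_trans _ ha).
  rewrite real_normK ?num_real//; move: (a ord0 i) (xi ord0 i) => u v hu /=.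
  (* The identity behind this is [2 (v - u) ^ 2 + 2 u ^ 2 - v ^ 2 = (v - 2 u) ^ 2]. *)
  by have := sqr_ge0 (v - 2 * u); nra.
have s0 := sqnorm_ge0 (xi - a).
have w1 : 1 <= w by lra.
have N2 : 1 <= N ^+ 2 by rewrite exprn_ege1.
have nb : 0 <= n%:R * b ^+ 2 by rewrite mulr_ge0// sqr_ge0.
have e1 : 2 * w <= 2 * (N ^+ 2 * w) by rewrite ler_wpM2l// ler_peMl// (le_trans ler01).
have e2 : n%:R * b ^+ 2 * N ^+ 2 <= n%:R * b ^+ 2 * N ^+ 2 * w.
  by rewrite ler_peMr// mulr_ge0// sqr_ge0.
rewrite [leRHS](_ : _ = 2 * (N ^+ 2 * w) + 2 * (n%:R * b ^+ 2 * N ^+ 2 * w)); last by ring.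
have e3 : n%:R * (2 * (b * N) ^+ 2) = 2 * (n%:R * b ^+ 2 * N ^+ 2) by ring.
lra.
Qed.

(** Each of the [N ^ n] cubes of side [dl / N] contributes a multiple of [J (dl / N) ^ n], with
    [J = m ^ 2]; the powers of [N] cancel in the sum. *)
Lemma train_maximal_ge : exists2 a, 0 < a & exists m0, forall m : nat, (m0 <= m)%N ->
  forall M, maximal_L1_le P (fun xi =>
    (train_hat (fun j : 'I_(m ^ 2) => train_center (m%:R ^+ 3) j) xi)%:C) M ->
  a * m%:R ^+ 2 <= 2 * M.
Proof.
have [K K0 HK] := phase_estimate (ltnW k_gt1) k_odd i0E i1E P_deg c1_gt0 rho_gt0 c2E
  Q_form Q_vars P_lead.
have r0 : 0 < rho^-1 by rewrite invr_gt0.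
have n0 : 0 < n%:R :> R by rewrite ltr0n (leq_trans _ (ltn_ord i1)).
have n2 : 2 <= n%:R :> R by rewrite ler_nat (leq_trans _ (ltn_ord i1)) ?i1E.
have k0 : 0 < k%:R :> R by rewrite ltr0n ltnW.
pose T := (1 + rho^-1) / (2 * k%:R * c1).
have T0 : 0 < T by rewrite divr_gt0 ?addr_gt0 ?mulr_gt0.
have b0 : 0 < b by rewrite /b; lra.
(* The bracket collects the cost of freezing [x] in its cube, of moving [xi] to the centre, and of
   [phase_estimate]; its factor 2 is that of [normc_cexpiB_le]. The last 2 covers frequencies far
   from the centre. *)
pose K1 := 2 * (n%:R * (b + 1) + n%:R + T * K) + 2.
have K10 : 0 < K1 by rewrite /K1; have := mulr_gt0 n0 b0; have := mulr_gt0 T0 K0; lra.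
pose H := \int[@lebesgue_measure R]_y (inv1sqr y ^+ 2).
have H0 : 0 < H ^+ n by rewrite exprn_gt0//; exact: integral_sqr_inv1sqr_gt0.
have pin : 0 < (pi : R) ^+ n by rewrite exprn_gt0// pi_gt0.
(* The first bound keeps the grid inside the unit ball, the second keeps the error below half of the
   main term. *)
pose dl := Num.min n%:R^-1 (H ^+ n / (4 * K1 * pi ^+ n)).
have dl0 : 0 < dl by rewrite lt_min invr_gt0 n0 /= divr_gt0// !mulr_gt0.
have dln : dl <= n%:R^-1 by rewrite ge_min lexx.
have dlH : 2 * (dl * K1) * pi ^+ n <= H ^+ n / 2.
  have : dl <= H ^+ n / (4 * K1 * pi ^+ n) by rewrite ge_min lexx orbT.
  by rewrite ler_pdivlMr ?mulr_gt0//; lra.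
have dl1 : dl <= 2^-1 by rewrite (le_trans dln)// lef_pV2 ?posrE.
pose kap : R := expR (- 8) / 2.
have kap0 : 0 < kap by rewrite divr_gt0// expR_gt0.
exists ((2 * pi) ^- n * (H ^+ n / 2) * (kap * dl) ^+ n).
  have p0 : 0 < 2 * pi :> R by rewrite mulr_gt0// pi_gt0.
  apply: mulr_gt0; last by rewrite exprn_gt0// mulr_gt0.
  by apply: mulr_gt0; [rewrite invr_gt0 exprn_gt0|exact: divr_gt0].
(* Largeness serves twice: [N > T] puts the times below 1, and [dl * N >= 1] handles the tails. *)
have [m0 Hm0] : exists m0 : nat, T + dl^-1 + 1 <= m0%:R.
  exists (Num.truncn (T + dl^-1 + 1)).+1; by rewrite ltW// truncnS_gt.
exists m0 => m mm0 M HM.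
have m1 : 1 <= m%:R :> R.
  by rewrite (le_trans _ (_ : m0%:R <= _)) ?ler_nat// (le_trans _ Hm0)//
    lerDr addr_ge0 ?invr_ge0// ltW.
have mN : m%:R <= m%:R ^+ 3 :> R by rewrite exprS ler_peMr// exprn_ege1.
set N : R := m%:R ^+ 3 in HM mN *.
have N1 : 1 <= N by exact: le_trans mN.
have N0 : 0 < N by exact: lt_le_trans N1.
have NT : T + dl^-1 + 1 <= N by rewrite (le_trans Hm0)// (le_trans _ mN)// ler_nat.
have NE : N = (m ^ 3)%:R by rewrite natrX.
(* Frequencies are of size [N], so [x . xi] varies by a multiple of [dl] over such a cube. As [N] is
   an integer, [N] intervals of length [r] tile [[- dl, 0]]. *)
pose r := dl / N.
have r_gt0 : 0 < r by rewrite divr_gt0.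
have rN : r * N = dl by rewrite /r mulfVK ?gt_eqF.
pose L := {ffun 'I_n -> 'I_(m ^ 3)}.
pose y (l : L) : 'rV[R]_n := \row_i grid_corner r (l i).
have yE l i : y l ord0 i = grid_corner r (l i) by rewrite mxE.
have yb l i : - dl <= y l ord0 i <= - r.
  rewrite yE /grid_corner lerN2 lerN2 -rN NE ler_pM2l// ler_nat ltn_ord /=.
  by rewrite ler_peMr ?(ltW r_gt0)// ler1n.
have yn l i : `|y l ord0 i| <= dl.
  by have /andP[? ?] := yb l i; rewrite ler0_norm; lra.
(* Along the train [y . xi] grows by [y_0 + y_1 / rho] per unit of [j], and [P] by
   [2 k c1 N ^ (k - 1)] to main order; this time balances the two. *)
pose t (l : L) := - (y l ord0 i0 + y l ord0 i1 / rho) / (2 * k%:R * c1 * N ^+ k.-1).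
have Nk0 : 0 < N ^+ k.-1 by rewrite exprn_gt0.
have t0 l : 0 < t l.
  rewrite divr_gt0 ?mulr_gt0// oppr_gt0.
  have /andP[_ ?] := yb l i0; have /andP[_ y1] := yb l i1.
  have : y l ord0 i1 / rho < 0 by rewrite pmulr_llt0//; lra.
  by lra.
have tN l : t l * N ^+ k.-1 <= dl * T.
  rewrite (_ : t l * _ = - (y l ord0 i0 + y l ord0 i1 / rho) / (2 * k%:R * c1)); last first.
    by rewrite /t; field; rewrite !gt_eqF.
  rewrite /T mulrA ler_wpM2r ?invr_ge0 ?mulr_ge0 ?(ltW c1_gt0)//.
  have /andP[y0 _] := yb l i0; have /andP[y1 _] := yb l i1.
  have : - dl * rho^-1 <= y l ord0 i1 / rho by rewrite ler_wpM2r// ltW.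
  by lra.
have t1 l : t l < 1.
  have NNk : N <= N ^+ k.-1.
    by rewrite -[leLHS]expr1 ler_weXn2l// -ltnS prednK ?(ltnW k_gt1).
  have : t l * N <= dl * T.
    by rewrite (le_trans _ (tN l))// ler_wpM2l// ltW.
  have i0' : 0 < dl^-1 by rewrite invr_gt0.
  have : t l * N < 1 * N -> t l < 1 by rewrite ltr_pM2r.
  by move=> h1 h2; apply: h1; nra.
pose psi (l : L) := cube_bump (fun i => grid_corner r (l i)) r.
have tpsi l : test_function (@unit_ball R n) (fun x => (psi l x)%:C).
  apply: test_function_cube_bump => // x xl; rewrite /unit_ball /=.
  have xn i : `|x ord0 i| <= dl.
    have := xl i; rewrite -yE => /andP[? ?]; have /andP[? ?] := yb l i.
    by rewrite ler0_norm; lra.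
  have := norm_dotp_le xn xn; rewrite ger0_norm ?sqnorm_ge0// -/(sqnorm x) => sx.
  rewrite -[ltRHS]sqrtr1 ltr_sqrt// (le_lt_trans sx)//.
  have ndl : n%:R * dl <= 1 by rewrite mulrC -ler_pdivlMr// div1r.
  by rewrite mulrA; nra.
have ipsi l : (lebesgue_rV n).-integrable setT (EFin \o psi l).
  exact: integrable_cube_bump.
have mpsi l : measurable_fun setT (psi l) by apply/measurable_EFinP; exact: measurable_int (ipsi l).
have psi0 l x : 0 <= psi l x by exact: cube_bump_ge0.
have t01 l : 0 < t l < 1 by rewrite t0 t1.
have := maximal_pairing_sum HM t01 tpsi mpsi psi0 (fun x => sum_cube_bump_le1 _ x r_gt0).
apply: le_trans.
have psiI l : (kap * r) ^+ n <= \int[lebesgue_rV n]_x psi l x.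
  exact: integral_cube_bump_ge.
have key l : (2 * pi) ^- n * ((m ^ 2)%:R * (kap * r) ^+ n * (H ^+ n / 2)) <=
    normc (propagator P (t l) (fun xi =>
      (train_hat (fun j : 'I_(m ^ 2) => train_center N j) xi)%:C) (fun x => (psi l x)%:C)).
  (* This is the centre for [j = 0]; the reference phase thus depends on the cube only. *)
  pose v0 : 'rV[R]_n := \row_i (if i == i0 then N else if i == i1 then - N / rho else 0).
  pose theta0 := meval (fun i => v0 ord0 i) P * t l + dotp (y l) v0.
  have phase (j : 'I_(m ^ 2)) (xi x : 'rV[R]_n) : psi l x != 0 ->
      normc (cexpi (meval (fun i => xi ord0 i) P * t l + dotp x xi) - cexpi theta0) <=
      dl * K1 * \prod_(i < n) (1 + (xi ord0 i - train_center N j ord0 i) ^+ 2).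
    move=> px; set w := \prod_(i < n) _.
    set a := train_center N j in w *.
    have jm : j%:R <= m%:R ^+ 2 :> R by rewrite -natrX ler_nat ltnW.
    have j0 : 0 <= j%:R :> R by [].
    have jN : j%:R <= N by rewrite (le_trans jm)// /N ler_weXn2l.
    have j3 : j%:R ^+ 3 <= N ^+ 2 :> R.
      by rewrite /N -exprM mulnC exprM lerXn2r ?nnegrE// exprn_ge0.
    have eta i : `|xi ord0 i - a ord0 i| <= w.
      have aE q : (xi - a) ord0 q = xi ord0 q - a ord0 q by rewrite mxE [(- a) _ _]mxE.
      have -> : w = \prod_(q < n) (1 + (xi - a) ord0 q ^+ 2).
        by apply: eq_bigr => q _; rewrite aE.
      apply: le_trans (prod1Dsqr_ge _); rewrite /sqnorm /dotp (bigD1 i)//= aE.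
      have s0 : 0 <= \sum_(q < n | q != i) (xi - a) ord0 q * (xi - a) ord0 q.
        by apply: sumr_ge0 => q _; rewrite -expr2 sqr_ge0.
      move: (xi ord0 i - a ord0 i) => u; rewrite -expr2 -[u ^+ 2]real_normK ?num_real//.
      by have := normr_ge0 u; nra.
    have w1 : 1 <= w.
      rewrite -[leLHS](_ : \prod_(i < n) 1 = 1); last by rewrite big1.
      by apply: ler_prod => i _; rewrite ler01 lerDl sqr_ge0.
    (* [phase_estimate] requires the distance to be at most [N]; beyond that, the trivial bound 2 is
       at most [2 * dl * w]. *)
    have [wN|wN] := leP w N; last first.
      apply: (@le_trans _ _ 2).
        by rewrite (le_trans (le_normcD _ _))// normcN !normc_cexpi.
      have : 1 <= dl * N.
        by rewrite mulrC -ler_pdivrMr// div1r; lra.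
      have : dl * N <= dl * w by rewrite ler_wpM2l// ltW.
      have dw : 0 <= dl * w by rewrite mulr_ge0 ?(ltW dl0)// (le_trans ler01).
      have : 2 * (dl * w) <= K1 * (dl * w).
        rewrite ler_wpM2r// /K1; have := mulr_gt0 T0 K0.
        have := mulr_gt0 n0 b0.
        by lra.
      by move=> h1 h2 h3; rewrite (mulrC dl K1) -mulrA; lra.
    apply: le_trans (normc_cexpiB_le _ _) _.
    have D1 : `|dotp (x - y l) xi| <= n%:R * (r * ((b + 1) * N)).
      apply: norm_dotp_le => i.
        have := cube_bump_neq0 r_gt0 px i; rewrite -yE !mxE => /andP[? ?].
        by rewrite ler_norml; apply/andP; split; lra.
      have := eta i; have := train_center_le i N1 jN; rewrite -/a => h1 h2.
      rewrite (_ : xi ord0 i = a ord0 i + (xi ord0 i - a ord0 i)); last by ring.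
      by rewrite (le_trans (ler_normD _ _))// mulrDl mul1r lerD// (le_trans h2).
    have D2 : `|dotp (y l) (xi - a)| <= n%:R * (dl * w).
      by apply: norm_dotp_le => [|i]; [exact: yn|rewrite mxE [(- a) _ _]mxE; exact: eta].
    have D3 := HK N j%:R w (fun i => xi ord0 i) (fun i => v0 ord0 i) w1 wN j0 jN j3.
    have {}D3 : `|meval (fun i => xi ord0 i) P - meval (fun i => v0 ord0 i) P -
        2 * k%:R * c1 * N ^+ k.-1 * j%:R| <= K * N ^+ k.-1 * w.
      apply: D3.
      - by rewrite -train_center0; exact: eta.
      - by rewrite -train_center1; exact: eta.
      - by move=> i h0 h1; have := eta i; rewrite /a train_center2// subr0.
      - by rewrite mxE eqxx.
      - by rewrite mxE i01 eqxx.
      - by move=> i /negbTE h0 /negbTE h1; rewrite mxE h0 h1.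
    (* The exact cancellation: this is minus [t l] times the linear term subtracted in [D3]. *)
    have D4 : dotp (y l) (a - v0) = - (t l * (2 * k%:R * c1 * N ^+ k.-1 * j%:R)).
      rewrite /dotp (bigD1 i0)//= (bigD1 i1) ?i01//= big1 ?addr0; last first.
        move=> i /andP[/negbTE h0 /negbTE h1].
        by rewrite /a !mxE h0 h1 subrr mulr0.
      rewrite [(a - v0) _ i0]mxE [(- v0) _ i0]mxE [v0 _ i0]mxE eqxx train_center0.
      rewrite [(a - v0) _ i1]mxE [(- v0) _ i1]mxE [v0 _ i1]mxE i01 eqxx train_center1.
      by rewrite /t; field; rewrite !gt_eqF.
    rewrite /theta0 (_ : _ - _ = dotp (x - y l) xi + dotp (y l) (xi - a) +
      t l * (meval (fun i => xi ord0 i) P - meval (fun i => v0 ord0 i) P -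
        2 * k%:R * c1 * N ^+ k.-1 * j%:R)); last first.
      have : dotp x xi - dotp (y l) v0 =
          dotp (x - y l) xi + dotp (y l) (xi - a) + dotp (y l) (a - v0).
        by rewrite !dotpBr ![dotp _ xi]dotpC dotpBr; ring.
      rewrite D4 => h.
      rewrite [LHS](_ : _ = (meval (fun i => xi ord0 i) P - meval (fun i => v0 ord0 i) P) * t l +
        (dotp x xi - dotp (y l) v0)); last by ring.
      by rewrite h; ring.
    have D5 : `|t l * (meval (fun i => xi ord0 i) P - meval (fun i => v0 ord0 i) P -
        2 * k%:R * c1 * N ^+ k.-1 * j%:R)| <= dl * T * (K * w).
      rewrite normrM (gtr0_norm (t0 l)).
      apply: le_trans (ler_wpM2l (ltW (t0 l)) D3) _.
      rewrite (_ : t l * _ = t l * N ^+ k.-1 * (K * w)); last by ring.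
      by rewrite ler_wpM2r// mulr_ge0 ?(ltW K0)// (le_trans ler01).
    have D6 : n%:R * (r * ((b + 1) * N)) <= n%:R * (b + 1) * (dl * w).
      rewrite [leLHS](_ : _ = n%:R * (b + 1) * (r * N)); last by ring.
      rewrite rN ler_wpM2l ?ler_peMr ?(ltW dl0)//.
      by rewrite mulr_ge0// addr_ge0// ltW.
    have dw : 0 <= dl * w by rewrite mulr_ge0 ?(ltW dl0)// (le_trans ler01).
    rewrite (_ : dl * K1 * w = 2 * (n%:R * (b + 1) * (dl * w) + n%:R * (dl * w) +
      dl * T * (K * w)) + 2 * (dl * w)); last by rewrite /K1; ring.
    have := ler_normD (dotp (x - y l) xi + dotp (y l) (xi - a))
      (t l * (meval (fun i => xi ord0 i) P - meval (fun i => v0 ord0 i) P -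
        2 * k%:R * c1 * N ^+ k.-1 * j%:R)).
    have := ler_normD (dotp (x - y l) xi) (dotp (y l) (xi - a)).
    by lra.
  apply: le_trans (propagator_pairing_ge (ipsi l) (psi0 l) phase).
  have p0 : 0 <= (2 * pi) ^- n :> R by rewrite invr_ge0 exprn_ge0// mulr_ge0// pi_ge0.
  apply: ler_wpM2l => //; apply: ler_pM.
  - by rewrite mulr_ge0// exprn_ge0// mulr_ge0// ltW.
  - by rewrite divr_ge0// ltW.
  - by rewrite ler_wpM2l.
  - by rewrite -/H; lra.
apply: (@le_trans _ _ (\sum_(l : L) (2 * pi) ^- n * ((m ^ 2)%:R * (kap * r) ^+ n * (H ^+ n /
  2)))); last first.
  by apply: ler_sum => l _; exact: key.
rewrite sumr_const card_ffun !card_ord -[leRHS]mulr_natl natrX -NE -rN natrX.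
rewrite [kap * (r * N)]mulrA [(kap * r * N) ^+ n]exprMn le_eqVlt; apply/orP; left; apply/eqP.
by ring.
Qed.

End train_growth.
End growth.

(** * Comparison of the two bounds for long trains *)

Theorem corollary1p4 (R : realType) (n k : nat) (hn : (1 < n)%N)
    (hk : (2 < k)%N) (hk_odd : odd k) (P Q : mpoly n R) (c1 c2 s : R)
    (P_deg : mmeasure mdeg P = k.+1)
    (c1_gt0 : 0 < c1) (c2_gt0 : 0 < c2)
    (Q_form : Q \is ishomog1 k mdeg)
    (Q_vars : free_of_first 2 Q)
    (P_lead : pihomog mdeg k P =
      c1 *: mpolyX R (mnm1 (Ordinal (ltnW hn))) ^+ k +
      c2 *: mpolyX R (mnm1 (Ordinal hn)) ^+ k + Q)
    (maximal : exists C : R, forall u uhat, in_sobolev s u uhat ->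
      maximal_L1_le P uhat (C * sobolev_norm s uhat)) :
  3^-1 <= s.
Proof.
have [C HC] := maximal.
pose i0 := Ordinal (ltnW hn); pose i1 := Ordinal hn.
have [a a0 [m0 Ha]] := train_maximal_ge (i0 := i0) (i1 := i1) (ltnW hk) hk_odd
  (erefl 0%N) (erefl 1%N) P_deg c1_gt0 c2_gt0 Q_form Q_vars P_lead.
rewrite leNgt; apply/negP => s13.
(* The Sobolev weight is at least 1, so a negative exponent may be raised to 0, still below 1/3. *)
pose sg := Num.max s 0.
have sg0 : 0 <= sg by rewrite le_max lexx orbT.
have ssg : s <= sg by rewrite le_max lexx.
have sg13 : sg < 3^-1 by rewrite /sg; case: (leP s 0) => h;
  rewrite ?(max_idPr h) ?(max_idPl (ltW h))// ?invr_gt0.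
pose b := 3 + 3 / (c2 / c1) `^ k%:R^-1.
pose A0 := 2 + 2 * n%:R * b ^+ 2.
have A01 : 1 <= A0.
  have : 0 <= 2 * n%:R * b ^+ 2 by apply: mulr_ge0; rewrite ?sqr_ge0// mulr_ge0.
  by rewrite /A0; lra.
(* Squaring the maximal estimate gives [a ^ 2 m ^ 4] on the left and [B2 m ^ (6 sg) m ^ 2] on the
   right; this is the constant left after dividing by the powers of [m]. *)
pose B2 := 4 * C ^+ 2 * ((2 * pi) ^- n * (8 * A0 `^ sg * pi ^+ n)).
have key m : (m0 <= m)%N -> (0 < m)%N -> a ^+ 2 * m%:R `^ (2 - 6 * sg) <= B2.
  move=> mm0 m_gt0; have m1 : 1 <= m%:R :> R by rewrite ler1n.
  have mR0 : 0 < m%:R :> R by rewrite ltr0n.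
  set c := fun j : 'I_(m ^ 2) => train_center k i0 i1 c1 c2 (m%:R ^+ 3) j.
  have N1 : 1 <= m%:R ^+ 3 :> R by rewrite exprn_ege1.
  have N21 : 1 <= (m%:R ^+ 3) ^+ 2 :> R by rewrite exprn_ege1.
  have hJ (j : 'I_(m ^ 2)) : j%:R <= m%:R ^+ 3 :> R.
    by rewrite -natrX ler_nat (leq_trans (ltnW (ltn_ord j)))// leq_pexp2l.
  have cS j : c j ord0 i0 = m%:R ^+ 3 + j%:R by exact: train_center0.
  have sg1 : sg <= 1 by rewrite ltW// (lt_trans sg13)// invf_lt1// ltr1n.
  have A1 : 1 <= A0 * (m%:R ^+ 3) ^+ 2 by rewrite -[leLHS]mulr1 ler_pM.
  have hw j xi : 1 + sqnorm xi <= A0 * (m%:R ^+ 3) ^+ 2 *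
      \prod_(i < n) (1 + (xi ord0 i - c j ord0 i) ^+ 2).
    by apply: sqnorm_train_center => //; exact: hJ.
  have hS := train_sobolev_le cS ssg sg0 sg1 A1 hw.
  set B := (X in (_ <= X%:E)%E) in hS.
  have S0 : (0 <= sobolev_sqnorm s (fun xi => (train_hat c xi)%:C))%E.
    apply: mule_ge0; first by rewrite lee_fin invr_ge0 exprn_ge0// mulr_ge0// pi_ge0.
    by apply: integral_ge0 => xi _; rewrite lee_fin mulr_ge0 ?powR_ge0 ?sqr_ge0.
  have u_in : in_sobolev s (train_dist c) (fun xi => (train_hat c xi)%:C).
    split; [exact: train_dist_tempered|exact: train_fourier_is|].
    by apply: le_lt_trans hS _; rewrite ltry.
  have /(Ha _ mm0) := HC _ _ u_in.
  rewrite /sobolev_norm; set nrm := Num.sqrt _ => h.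
  have n0 : 0 <= nrm by exact: sqrtr_ge0.
  have fS : fine (sobolev_sqnorm s (fun xi => (train_hat c xi)%:C)) <= B.
    by rewrite -lee_fin fineK// ge0_fin_numE// (le_lt_trans hS)// ltry.
  have nB : nrm ^+ 2 <= B by rewrite sqr_sqrtr// fine_ge0.
  (* The sign of [C] is not prescribed, so an absolute value is taken before squaring. *)
  have h2 : a * m%:R ^+ 2 <= 2 * `|C| * nrm.
    by rewrite (le_trans h)// -mulrA ler_wpM2l// ler_wpM2r// ler_norm.
  have h3 : (a * m%:R ^+ 2) ^+ 2 <= (2 * `|C| * nrm) ^+ 2.
    by rewrite lerXn2r ?nnegrE ?mulr_ge0 ?exprn_ge0 ?(ltW a0).
  have CE : `|C| ^+ 2 = C ^+ 2 by rewrite real_normK ?num_real.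
  have h4 : a ^+ 2 * m%:R ^+ 4 <= 4 * C ^+ 2 * B.
    rewrite (_ : a ^+ 2 * _ = (a * m%:R ^+ 2) ^+ 2); last by ring.
    rewrite (le_trans h3)// !exprMn CE (_ : 2 ^+ 2 = 4 :> R); last by ring.
    by rewrite ler_wpM2l// mulr_ge0// sqr_ge0.
  have BE : 4 * C ^+ 2 * B = B2 * m%:R `^ (6 * sg) * m%:R ^+ 2.
    rewrite /B /B2 powRM ?(le_trans ler01)// natrX.
    have -> : ((m%:R ^+ 3) ^+ 2) `^ sg = m%:R `^ (6 * sg) :> R.
      by rewrite -exprM -powR_mulrn ?ler0n// -powRrM.
    by ring.
  have mE : m%:R ^+ 4 = m%:R `^ (2 - 6 * sg) * m%:R `^ (6 * sg) * m%:R ^+ 2 :> R.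
    rewrite -powRD; last by rewrite (gt_eqF mR0); apply/implyP.
    by rewrite subrK powR_mulrn ?ler0n// -exprD.
  have p0 : 0 < m%:R `^ (6 * sg) * m%:R ^+ 2 :> R by rewrite mulr_gt0 ?powR_gt0 ?exprn_gt0.
  move: h4; rewrite BE mE => h5; rewrite -(ler_pM2r p0) [leRHS]mulrA.
  by apply: le_trans h5; rewrite -[leLHS]mulrA !mulrA.
pose p := 2 - 6 * sg.
have p0 : 0 < p by rewrite /p; lra.
(* Since [p > 0] exactly when [sg < 1/3], [m ^ p] is unbounded; this [m] exceeds the [p]-th root of
   [B2 / a ^ 2]. *)
pose m := (maxn m0 (Num.truncn ((B2 / a ^+ 2) `^ p^-1)).+1).
have m_gt0 : (0 < m)%N by rewrite leq_max orbT.
have := key m (leq_maxl _ _) m_gt0.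
rewrite -/p mulrC -ler_pdivlMr ?exprn_gt0// => h.
have : (m%:R `^ p) `^ p^-1 <= (B2 / a ^+ 2) `^ p^-1.
  by apply: ge0_ler_powR; rewrite ?invr_ge0 ?nnegrE ?(ltW p0) ?powR_ge0 ?(le_trans (powR_ge0 _
    _) h).
rewrite -powRrM divff ?gt_eqF// powRr1 ?ler0n//; apply/negP; rewrite -ltNge.
by rewrite (lt_le_trans (truncnS_gt _))// ler_nat leq_maxr.
Qed.
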